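(* For a Heyting algebra $H$, the following are equivalent: (1) $\mathbf{EsaEt}(\mathrm{Spec}(H))$ is an elementary topos; (2) $H$ is isomorphic to the lattice of truth values $\mathrm{Sub}_{\mathcal{E}}(1)$ of some finitely propositional elementary topos $\mathcal{E}$; (3) $H$ is étale-finite.
   Context: The lattice of truth values of an elementary topos $\mathcal{E}$ is the lattice $\mathrm{Sub}_{\mathcal{E}}(1)$ of subobjects of its terminal object. A category with a terminal object is finitely propositional if for every object $Y$ there is a finite jointly epimorphic family $\{V_i\to Y\}_{i\in I}$ with each $V_i$ subterminal (i.e. the unique morphism $V_i\to 1$ is a monomorphism). Étale-finite Heyting algebras. Let $H_0$ be a finite Heyting algebra. A Heyting homomorphism $f\colon H_0\to H$ satisfies Jibladze's law if $\bigvee_{x_0\in H_0}(x\leftrightarrow f(x_0))=1$ for every $x\in H$. A Heyting algebra $H$ is étale-finite if there are a finite Heyting algebra $H_0$ and a homomorphism $f\colon H_0\to H$ satisfying Jibladze's law. Priestley and Esakia spaces. An upset of a poset is an upward-closed subset; ${\downarrow}S$ denotes the downward closure of $S$. An ordered space is a poset equipped with a topology. A Priestley space is a compact ordered space $X$ such that whenever $x\nleq y$ there is a clopen upset $U$ with $x\in U$, $y\notin U$. An Esakia space is a Priestley space in which ${\downarrow}W$ is clopen for every clopen $W$. For a Heyting algebra $H$, $\mathrm{Spec}(H)$ is the dual Esakia space: the set of prime filters of $H$, ordered by inclusion, with the topology generated by the sets $\{F : a\in F\}$ and their complements, $a\in H$. Spectral local homeomorphisms. The spectral topology on a Priestley space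 is the topology consisting of all open upsets. A spectral local homeomorphism $f\colon Y\to X$ between Priestley spaces is a function that is a local homeomorphism with respect to the spectral topologies. The category $\mathbf{EsaEt}(X)$. For an Esakia space $X$, $\mathbf{EsaEt}(X)$ is the slice over $X$ of the category of Esakia spaces and spectral local homeomorphisms: objects are spectral local homeomorphisms $Y\to X$ with $Y$ an Esakia space, and morphisms from $Y_1\to X$ to $Y_2\to X$ are spectral local homeomorphisms $Y_1\to Y_2$ commuting with the maps to $X$. *)

(* Defs.v *)
From HB Require Import structures.
From mathcomp Require Import all_boot all_order finmap.
From mathcomp Require Import all_classical topology.

Set Implicit Arguments.
Unset Strict Implicit.
Unset Printing Implicit Defensive.

Import Order.TTheory.
Local Open Scope order_scope.
Local Open Scope classical_set_scope.

(* Distributivity is a consequence of [le_himp]; assuming it is harmless. *)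
HB.mixin Record TBDistrLattice_isHeyting d T of Order.TBDistrLattice d T := {
  himp : T -> T -> T;
  le_himp : forall a b c : T, (c <= himp a b)%O = (Order.meet c a <= b)%O
}.

#[short(type="heytingType")]
HB.structure Definition Heyting d :=
  { T of TBDistrLattice_isHeyting d T & Order.TBDistrLattice d T }.

#[short(type="finHeytingType")]
HB.structure Definition FinHeyting d :=
  { T of Heyting d T & Order.FinTBDistrLattice d T }.

Definition hiff d (H : heytingType d) (a b : H) : H :=
  Order.meet (himp a b) (himp b a).

Definition heyting_hom d d' (H : heytingType d) (H' : heytingType d')
    (f : H -> H') : Prop :=
  [/\ f \bot = \bot /\ f \top = \top,
      {morph f : a b / Order.meet a b},
      {morph f : a b / Order.join a b} &
      {morph f : a b / himp a b}].

Definition jibladze d0 d (H0 : finHeytingType d0) (H : heytingType d)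
    (f : H0 -> H) : Prop :=
  forall x : H, \join_(x0 : H0) hiff x (f x0) = \top.

Definition etale_finite d (H : heytingType d) : Prop :=
  exists (d0 : Order.disp_t) (H0 : finHeytingType d0) (f : H0 -> H),
    heyting_hom f /\ jibladze f.

Record category := Category {
  ob :> Type;
  hom : ob -> ob -> Type;
  idm : forall a, hom a a;
  compm : forall a b c, hom b c -> hom a b -> hom a c;
  comp1m : forall a b (f : hom a b), compm (idm b) f = f;
  compm1 : forall a b (f : hom a b), compm f (idm a) = f;
  compmA : forall a b c d (h : hom c d) (g : hom b c) (f : hom a b),
    compm h (compm g f) = compm (compm h g) f
}.
Arguments hom {_} _ _.
Arguments idm {_} _.
Arguments compm {_ _ _ _} _ _.

Notation "g \oc f" := (compm g f) (at level 40, left associativity).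

Definition monic (C : category) (a b : C) (m : hom a b) : Prop :=
  forall (c : C) (g h : hom c a), m \oc g = m \oc h -> g = h.

Definition is_terminal (C : category) (t : C) : Prop :=
  forall a : C, exists! f : hom a t, True.

Definition is_product (C : category) (a b p : C)
    (p1 : hom p a) (p2 : hom p b) : Prop :=
  forall (z : C) (f : hom z a) (g : hom z b),
    exists! h : hom z p, p1 \oc h = f /\ p2 \oc h = g.

Definition is_pullback (C : category) (a b c p : C) (f : hom a c)
    (g : hom b c) (p1 : hom p a) (p2 : hom p b) : Prop :=
  f \oc p1 = g \oc p2 /\
  forall (z : C) (u : hom z a) (v : hom z b), f \oc u = g \oc v ->
    exists! h : hom z p, p1 \oc h = u /\ p2 \oc h = v.

Record functor (J C : category) := Functor {
  fob :> J -> C;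
  fmap : forall i j, hom i j -> hom (fob i) (fob j);
  fmap1 : forall i, fmap (idm i) = idm (fob i);
  fmapM : forall i j k (g : hom j k) (f : hom i j),
    fmap (g \oc f) = fmap g \oc fmap f
}.

Definition is_cone (J C : category) (F : functor J C) (l : C)
    (p : forall j, hom l (F j)) : Prop :=
  forall (i j : J) (u : hom i j), fmap F u \oc p i = p j.

Definition is_limit (J C : category) (F : functor J C) (l : C)
    (p : forall j, hom l (F j)) : Prop :=
  is_cone p /\
  forall (z : C) (q : forall j, hom z (F j)), is_cone q ->
    exists! h : hom z l, forall j, p j \oc h = q j.

Definition finite_type (T : Type) : Prop :=
  exists (I : finType) (e : I -> T), bijective e.

Definition finite_category (J : category) : Prop :=
  finite_type J /\ forall i j : J, finite_type (hom i j).

Definition has_finite_limits (C : category) : Prop :=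
  forall (J : category) (F : functor J C), finite_category J ->
    exists (l : C) (p : forall j, hom l (F j)), is_limit p.

(* [ev : e * a -> b], where the product [e * a] is any product diagram
   [(p, p1, p2)], exhibits [e] as the exponential of [b] by [a]; the map [h]
   below is [g * id_a]. *)
Definition is_exponential (C : category) (a b e p : C)
    (p1 : hom p e) (p2 : hom p a) (ev : hom p b) : Prop :=
  is_product p1 p2 /\
  forall (z q : C) (q1 : hom q z) (q2 : hom q a), is_product q1 q2 ->
    forall f : hom q b,
      exists! g : hom z e, exists h : hom q p,
        [/\ p1 \oc h = g \oc q1, p2 \oc h = q2 & ev \oc h = f].

Definition has_exponentials (C : category) : Prop :=
  forall a b : C, exists (e p : C) (p1 : hom p e) (p2 : hom p a)
    (ev : hom p b), is_exponential p1 p2 ev.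

Definition is_subobject_classifier (C : category) (t omega : C)
    (tr : hom t omega) : Prop :=
  is_terminal t /\
  forall (a u : C) (m : hom u a), monic m ->
    exists! chi : hom a omega, exists k : hom u t, is_pullback chi tr m k.

Definition has_subobject_classifier (C : category) : Prop :=
  exists (t omega : C) (tr : hom t omega), is_subobject_classifier tr.

Definition elementary_topos (C : category) : Prop :=
  [/\ has_finite_limits C, has_exponentials C & has_subobject_classifier C].

Record mono_into (C : category) (a : C) := MonoInto {
  mono_dom : C;
  mono_map :> hom mono_dom a;
  mono_monic : monic mono_map
}.

Definition mono_le (C : category) (a : C) (m n : mono_into a) : Prop :=
  exists h : hom (mono_dom m) (mono_dom n), n \oc h = m.

(* Subobjects are the classes of monomorphisms that factor through each
   other. *)
Record subobject (C : category) (a : C) := SubobjectClass {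
  sub_class : mono_into a -> Prop;
  sub_classP : exists m, forall n,
    sub_class n <-> (mono_le m n /\ mono_le n m)
}.

Definition sub_le (C : category) (a : C) (S T : subobject a) : Prop :=
  exists m n : mono_into a, [/\ sub_class S m, sub_class T n & mono_le m n].

(* An order isomorphism between lattices is the same as a lattice
   isomorphism, so only the order of [subobject a] is needed. *)
Definition iso_subobjects d (H : heytingType d) (C : category) (a : C) : Prop :=
  exists f : H -> subobject a,
    bijective f /\ forall x y : H, (x <= y)%O <-> sub_le (f x) (f y).

Definition subterminal (C : category) (t v : C) : Prop :=
  exists f : hom v t, monic f.

Definition jointly_epic (C : category) (I : Type) (y : C) (V : I -> C)
    (v : forall i, hom (V i) y) : Prop :=
  forall (z : C) (g h : hom y z), (forall i, g \oc v i = h \oc v i) -> g = h.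

Definition finitely_propositional (C : category) (t : C) : Prop :=
  forall y : C, exists (I : finType) (V : I -> C) (v : forall i, hom (V i) y),
    jointly_epic v /\ forall i, subterminal t (V i).

Section Slice.
Variables (C : category) (x : C).

Record slice_ob := SliceOb { sl_ob :> C; sl_map : hom sl_ob x }.

Record slice_hom (y z : slice_ob) := SliceHom {
  sl_hom :> hom y z;
  sl_homP : sl_map z \oc sl_hom = sl_map y
}.

Lemma slice_hom_eq (y z : slice_ob) (f g : slice_hom y z) :
  sl_hom f = sl_hom g -> f = g.
Proof.
by case: f g => [f fP] [g gP] /= fg; subst g; congr SliceHom; apply: Prop_irrelevance.
Qed.

Definition slice_id (y : slice_ob) : slice_hom y y := SliceHom (compm1 (sl_map y)).

Lemma slice_comp_proof (a b c : slice_ob) (g : slice_hom b c)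
  (f : slice_hom a b) : sl_map c \oc (g \oc f) = sl_map a.
Proof. by rewrite compmA !sl_homP. Qed.

Definition slice_comp (a b c : slice_ob) (g : slice_hom b c)
  (f : slice_hom a b) : slice_hom a c := SliceHom (slice_comp_proof g f).

Definition slice : category.
Proof.
apply: (@Category slice_ob slice_hom slice_id slice_comp) => *;
  apply: slice_hom_eq; [exact: comp1m | exact: compm1 | exact: compmA].
Defined.

End Slice.

Notation orderedSpace := POrderedTopological.type.

Section OrderedSpaces.
Context {d : Order.disp_t}.
Implicit Types X : orderedSpace d.

Definition upset X (U : set X) : Prop := forall x y : X, x <= y -> U x -> U y.

Definition downclosure X (S : set X) : set X := [set x | exists2 y, S y & x <= y].

Definition priestley X : Prop :=
  compact [set: X] /\
  forall x y : X, ~~ (x <= y) ->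
    exists U : set X, [/\ clopen U, upset U, U x & ~ U y].

Definition esakia X : Prop :=
  priestley X /\ forall W : set X, clopen W -> clopen (downclosure W).

(* The underlying set of X, with the open upsets as open sets. *)
Definition spectral X : Type := X.

End OrderedSpaces.

Section SpectralTopology.
Context {d : Order.disp_t} (X : orderedSpace d).

Let op (U : set (spectral X)) : Prop := @open X U /\ @upset d X U.

Let opT : op setT. Proof. by split; [exact: openT|]. Qed.

Let opI : setI_closed op.
Proof.
move=> A B [oA uA] [oB uB]; split; first exact: openI.
by move=> x y xy [Ax Bx]; split; [exact: uA Ax|exact: uB Bx].
Qed.

Let op_bigU (I : Type) (f : I -> set X) :
  (forall i, op (f i)) -> op (\bigcup_i f i).
Proof.
move=> opf; split; first by apply: bigcup_open => i _; exact: (opf i).1.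
by move=> x y xy [i _ fx]; exists i => //; exact: (opf i).2 fx.
Qed.

HB.instance Definition _ := Choice.copy (spectral X) X.
HB.instance Definition _ := isOpenTopological.Build (spectral X) opT opI op_bigU.

End SpectralTopology.

Definition restricts_to_homeomorphism (Y X : topologicalType) (f : Y -> X)
    (U : set Y) : Prop :=
  exists g : X -> Y, [/\ {in U, cancel f g}, {within U, continuous f} &
                         {within f @` U, continuous g}].

Definition local_homeomorphism (Y X : topologicalType) (f : Y -> X) : Prop :=
  forall y : Y, exists U : set Y,
    [/\ open U, U y, open (f @` U) & restricts_to_homeomorphism f U].

Definition spectral_local_homeomorphism d (Y X : orderedSpace d) (f : Y -> X) :=
  @local_homeomorphism (spectral Y) (spectral X) f.

Lemma local_homeomorphism_id (X : topologicalType) :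
  local_homeomorphism (@id X).
Proof.
move=> x; exists setT; rewrite image_id; split; [exact: openT| |exact: openT|] => //.
have idc (A : set X) : {within A, continuous (@id X)}.
  by apply: continuous_subspaceT => y; exact: cvg_id.
by exists id; split; [move=> y|exact: idc|exact: idc].
Qed.

Lemma local_homeomorphism_comp (Z Y X : topologicalType) (g : Z -> Y)
    (f : Y -> X) :
  local_homeomorphism g -> local_homeomorphism f ->
  local_homeomorphism (f \o g).
Proof.
have pre (S T : topologicalType) (A : set S) (h : S -> T) (B : set T) :
    open A -> {within A, continuous h} -> open B -> open (A `&` h @^-1` B).
  move=> oA; rewrite continuous_open_subspace // => ch oB.
  rewrite openE => s [As Bs]; apply: filterI; first exact: open_nbhs_nbhs.
  by apply: (ch s); [rewrite inE|apply: open_nbhs_nbhs].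
move=> gP fP z; have [U [oU Uz ogU [g' [gK cg cg']]]] := gP z.
have [V [oV Vz ofV [f' [fK cf cf']]]] := fP (g z).
pose W := U `&` g @^-1` V.
have oW : open W by exact: pre.
have WE : (f \o g) @` W = f @` V `&` f' @^-1` (g @` U).
  apply/seteqP; split=> [x [w [Uw Vw] <-]|x [[v Vv <-] [u Uu uv]]].
    by split; [exists (g w)|exists w => //=; rewrite fK ?inE].
  have uv' : g u = v by rewrite uv fK ?inE.
  by exists u; [split => //=; rewrite uv'|rewrite /= uv'].
have ofW : open ((f \o g) @` W) by rewrite WE; exact: pre.
exists W; split => //; exists (g' \o f'); split.
- by move=> w; rewrite inE => -[Uw Vw] /=; rewrite fK ?inE // gK ?inE.
- move: cg cf; rewrite !continuous_open_subspace // => cg cf w.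
  rewrite inE => -[Uw Vw]; apply: continuous_comp; first by apply: cg; rewrite inE.
  by apply: cf; rewrite inE.
- move: cg' cf'; rewrite !continuous_open_subspace // => cg' cf' w.
  rewrite inE WE => -[Vw Uw]; apply: continuous_comp; first by apply: cf'; rewrite inE.
  by apply: cg'; rewrite inE.
Qed.

Record esakiaSpace d := EsakiaSpace {
  esakia_sort :> orderedSpace d;
  esakiaP : esakia esakia_sort
}.

Record esakia_hom d (Y X : esakiaSpace d) := EsakiaHom {
  esakia_fun :> Y -> X;
  esakia_funP : spectral_local_homeomorphism esakia_fun
}.

Lemma esakia_hom_eq d (Y X : esakiaSpace d) (f g : esakia_hom Y X) :
  esakia_fun f = esakia_fun g -> f = g.
Proof.
by case: f g => [f fP] [g gP] /= fg; subst g; congr EsakiaHom; apply: Prop_irrelevance.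
Qed.

Definition esakia_id d (X : esakiaSpace d) : esakia_hom X X :=
  EsakiaHom (@local_homeomorphism_id (spectral X)).

Definition esakia_comp d (Z Y X : esakiaSpace d) (f : esakia_hom Y X)
    (g : esakia_hom Z Y) : esakia_hom Z X :=
  @EsakiaHom d Z X (f \o g)
    (local_homeomorphism_comp (@esakia_funP d Z Y g) (@esakia_funP d Y X f)).

Definition EsaLH (d : Order.disp_t) : category.
Proof.
by apply: (@Category (esakiaSpace d) (@esakia_hom d) (@esakia_id d)
  (@esakia_comp d)) => *; exact: esakia_hom_eq.
Defined.

Definition EsaEt d (X : esakiaSpace d) : category := @slice (EsaLH d) X.

Section Spec.
Context {d : Order.disp_t} (H : heytingType d).

Record lattice_filter (F : set H) : Prop := LatticeFilter {
  lfilterT : F \top;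
  lfilterI : forall a b, F a -> F b -> F (Order.meet a b);
  lfilterS : forall a b, a <= b -> F a -> F b
}.

Record prime_filter (F : set H) : Prop := PrimeFilter {
  prime_filter_filter :> lattice_filter F;
  prime_filter0 : ~ F \bot;
  prime_filterU : forall a b, F (Order.join a b) -> F a \/ F b
}.

Record spec := MkSpec { spec_val :> set H; spec_prime : prime_filter spec_val }.

Lemma spec_eq (F G : spec) : spec_val F = spec_val G -> F = G.
Proof.
by case: F G => [F FP] [G GP] /= FG; subst G; congr MkSpec; apply: Prop_irrelevance.
Qed.

HB.instance Definition _ := gen_eqMixin spec.
HB.instance Definition _ := gen_choiceMixin spec.

Definition spec_le (F G : spec) : bool := `[< spec_val F `<=` spec_val G >].

Let spec_le_refl : reflexive spec_le. Proof. by move=> F; apply/asboolP. Qed.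

Let spec_le_anti : antisymmetric spec_le.
Proof.
by move=> F G /andP[/asboolP FG /asboolP GF]; apply/spec_eq/seteqP.
Qed.

Let spec_le_trans : transitive spec_le.
Proof.
move=> G F K /asboolP FG /asboolP GK; apply/asboolP.
exact: subset_trans FG GK.
Qed.

HB.instance Definition _ :=
  Order.Le_isPOrder.Build d spec spec_le_refl spec_le_anti spec_le_trans.

Definition spec_basic (a : H) : set spec := [set F | spec_val F a].

Definition spec_subbase : set (set spec) :=
  [set A | exists a, A = spec_basic a \/ A = ~` spec_basic a].

HB.instance Definition _ := isSubBaseTopological.Build spec spec_subbase id.

Lemma open_spec_subbase (A : set spec) : spec_subbase A -> open A.
Proof.
move=> DA; exists [set A]; last by rewrite bigcup_set1.
by move=> _ ->; apply: finI_from1.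
Qed.

Lemma spec_basic_clopen (a : H) : clopen (spec_basic a).
Proof.
by split; [|rewrite -openC]; apply: open_spec_subbase; exists a; [left|right].
Qed.

Lemma spec_nbhs (F : spec) (W : set spec) : open W -> W F ->
  exists a b, [/\ spec_val F a, ~ spec_val F b &
                  spec_basic a `&` ~` spec_basic b `<=` W].
Proof.
case=> D' D'sub <- [B D'B BF]; have [S Ssub SB] := D'sub _ D'B.
suff [a [b [Fa Fb abS]]] : exists a b, [/\ spec_val F a, ~ spec_val F b &
    spec_basic a `&` ~` spec_basic b `<=` \bigcap_(i in [set` S]) i].
  by exists a, b; split=> // G /abS; rewrite SB => BG; exists B.
have SF i : i \in S -> i F by move=> iS; move: BF; rewrite -SB; apply.
have {}Ssub i : i \in S -> spec_subbase i by move=> /Ssub; rewrite inE.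
suff : forall s : seq (set spec), (forall i, i \in s -> i F) ->
    (forall i, i \in s -> spec_subbase i) ->
    exists a b, [/\ spec_val F a, ~ spec_val F b &
      spec_basic a `&` ~` spec_basic b `<=` \bigcap_(i in [set` s]) i].
  exact.
have FP := spec_prime F.
elim=> [|A s IHs] sF sD.
  by exists \top, \bot; split; [exact: lfilterT FP|exact: prime_filter0 FP|].
have [i si|i si|a [b [Fa Fb abs]]] := IHs.
- by apply: sF; rewrite inE si orbT.
- by apply: sD; rewrite inE si orbT.
have AF : A F by apply: sF; rewrite inE eqxx.
have [c [Ac|Ac]] : spec_subbase A by apply: sD; rewrite inE eqxx.
  exists (Order.meet a c), b; split=> //.
    by apply: (lfilterI FP) => //; move: AF; rewrite Ac.
  move=> G [Gac Gb] i /=; rewrite inE => /predU1P[->|si].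
    by rewrite Ac; apply: (lfilterS (spec_prime G)) Gac; exact: leIr.
  apply: abs => //; split=> //.
  by apply: (lfilterS (spec_prime G)) Gac; exact: leIl.
exists a, (Order.join b c); split=> //.
  by move=> /(prime_filterU FP)[//|]; move: AF; rewrite Ac.
move=> G [Ga Gbc] i /=; rewrite inE => /predU1P[->|si].
  rewrite Ac => Gc; apply: Gbc.
  by apply: (lfilterS (spec_prime G)) Gc; exact: leUr.
apply: abs => //; split=> // Gb; apply: Gbc.
by apply: (lfilterS (spec_prime G)) Gb; exact: leUl.
Qed.

Lemma spec_compact : compact [set: spec].
Proof.
rewrite compact_ultra => U UU _.
pose P : set H := [set a | U (spec_basic a)].
have PP : prime_filter P.
  split; first split.
  - by apply: filterS filterT => F _; exact: lfilterT (spec_prime F).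
  - move=> a b Pa Pb; apply: filterS (filterI Pa Pb) => F [Fa Fb].
    exact: lfilterI (spec_prime F) _ _ Fa Fb.
  - by move=> a b ab; apply: filterS => F; exact: lfilterS (spec_prime F) _ _ ab.
  - by move=> /filter_ex[F]; exact: prime_filter0 (spec_prime F).
  - move=> a b Pab; have [?|Pa] := in_ultra_setVsetC (spec_basic a) UU; first by left.
    right; apply: filterS (filterI Pab Pa) => F [Fab Fa].
    by have [/Fa|] := prime_filterU (spec_prime F) Fab.
exists (MkSpec PP); split=> // A; rewrite nbhsE => -[B [oB BP] BA].
have [a [b [Pa Pb abB]]] := spec_nbhs oB BP.
apply: filterS BA _; apply: filterS abB _; apply: filterI => //.
by have [/Pb|] := in_ultra_setVsetC (spec_basic b) UU.
Qed.

Lemma prime_filter_ext (F : set H) (b : H) : lattice_filter F -> ~ F b ->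
  exists G : spec, F `<=` G /\ ~ spec_val G b.
Proof.
move=> FF Fb; pose P (A : set H) := lattice_filter (A `|` F) /\ ~ (A `|` F) b.
have [S SP Stot|M [[MF Mb] maxM]] := @Zorn_bigcup H P.
  have inS A z : S A -> (A `|` F) z -> ((\bigcup_(X in S) X) `|` F) z.
    by move=> SA [Az|Fz]; [left; exists A|right].
  split; last by case=> // -[A SA Ab]; apply: (SP _ SA).2; left.
  split.
  - by right; exact: lfilterT FF.
  - move=> x y [[A SA Ax]|Fx] [[B SB By]|Fy].
    + have [AB|BA] := Stot _ _ SA SB.
        by apply: (inS _ _ SB); apply: (lfilterI (SP _ SB).1); left=> //; exact: AB.
      by apply: (inS _ _ SA); apply: (lfilterI (SP _ SA).1); left=> //; exact: BA.
    + by apply: (inS _ _ SA); apply: (lfilterI (SP _ SA).1); [left|right].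
    + by apply: (inS _ _ SB); apply: (lfilterI (SP _ SB).1); [right|left].
    + by right; exact: lfilterI FF _ _ Fx Fy.
  - move=> x y xy [[A SA Ax]|Fx]; last by right; exact: lfilterS FF _ _ xy Fx.
    by apply: (inS _ _ SA); apply: (lfilterS (SP _ SA).1 xy); left.
pose G := M `|` F.
have gen c : ~ G c -> exists2 g, G g & Order.meet g c <= b.
  move=> Gc; apply: contrapT => nb.
  pose K : set H := [set x | exists2 g, G g & Order.meet g c <= x].
  have GK : G `<=` K by move=> g Gg; exists g => //; exact: leIl.
  have KF : K `|` F = K by apply/setUidPl => x Fx; apply: GK; right.
  apply: (maxM K).
    split; first by move=> x Mx; apply: GK; left.
    by move=> /(_ c) KM; apply: Gc; left; apply: KM; exists \top;
      [exact: lfilterT|exact: leIr].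
  split; rewrite KF //; split.
  - by exists \top; [exact: lfilterT|exact: lex1].
  - move=> x y [g Gg gx] [h Gh hy]; exists (Order.meet g h); first exact: lfilterI.
    by rewrite lexI (le_trans _ gx) ?(le_trans _ hy) // leI2 ?leIl ?leIr.
  - by move=> x y xy [g Gg gx]; exists g => //; exact: le_trans gx xy.
suff GP : prime_filter G by exists (MkSpec GP); split=> // x Fx; right.
split=> // [G0|x y Gxy]; first by apply: Mb; exact: (lfilterS MF (le0x b)).
apply: contrapT => /not_orP[/gen[g Gg gx] /gen[h Gh hy]]; apply: Mb.
apply: (@lfilterS _ MF (Order.meet (Order.meet g h) (Order.join x y))).
  rewrite meetUr leUx (le_trans _ gx) ?(le_trans _ hy) // leI2 ?leIl ?leIr //.
by apply: lfilterI => //; exact: lfilterI.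
Qed.

Lemma downclosure_spec_basic (a b : H) :
  downclosure (spec_basic a `&` ~` spec_basic b) = ~` spec_basic (himp a b).
Proof.
apply/seteqP; split=> F.
  move=> [G [Ga Gb] /asboolP FG Fab]; apply: Gb.
  apply: (@lfilterS _ (spec_prime G) (Order.meet (himp a b) a)).
    by rewrite -le_himp.
  by apply: lfilterI (spec_prime G) _ _ _ Ga; exact: FG.
move=> Fab; have FF := spec_prime F.
pose K : set H := [set x | exists2 f, spec_val F f & Order.meet f a <= x].
have [||G [KG Gb]] := @prime_filter_ext K b.
- split.
  + by exists \top; [exact: lfilterT FF|exact: lex1].
  + move=> x y [g Gg gx] [h Gh hy]; exists (Order.meet g h); first exact: lfilterI FF _ _ Gg Gh.
    by rewrite lexI (le_trans _ gx) ?(le_trans _ hy) // leI2 ?leIl ?leIr.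
  + by move=> x y xy [g Gg gx]; exists g => //; exact: le_trans gx xy.
- by case=> f Ff; rewrite -le_himp => fab; apply: Fab; exact: lfilterS FF _ _ fab Ff.
exists G; last by apply/asboolP => x Fx; apply: KG; exists x => //; exact: leIl.
by split=> //; apply: KG; exists \top; [exact: lfilterT FF|exact: leIr].
Qed.

Lemma spec_esakia : esakia spec.
Proof.
split; first split; first exact: spec_compact.
  move=> F G /asboolPn/existsNP[a /not_implyP[Fa Ga]]; exists (spec_basic a).
  split=> //; first exact: spec_basic_clopen.
  by move=> K L /asboolP KL; exact: KL.
move=> W [oW cW]; split.
  rewrite openE => F [G WG FG]; have [a [b [Ga Gb abW]]] := spec_nbhs oW WG.
  rewrite /interior; have : (~` spec_basic (himp a b)) F.
    by rewrite -downclosure_spec_basic; exists G.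
  have : open (~` spec_basic (himp a b)).
    by rewrite openC; exact: (spec_basic_clopen _).2.
  move=> oab abF; apply: filterS (open_nbhs_nbhs (conj oab abF)) => K.
  by rewrite -downclosure_spec_basic => -[L /abW WL KL]; exists L.
have /compact_near_coveringP cptW : compact W.
  by apply: subclosed_compact cW spec_compact _.
rewrite -openC openE => F FW; have FF := spec_prime F; rewrite /interior.
pose B (a : H) : set H := [set b | spec_val F b /\ b <= a].
have filtB : Filter (filter_from (spec_val F) B).
  apply: filter_from_filter; first by exists \top; exact: lfilterT FF.
  move=> a b Fa Fb; exists (Order.meet a b); first exact: lfilterI FF _ _ Fa Fb.
  by move=> c [Fc]; rewrite lexI => /andP[ca cb].
have [|a Fa aW] := cptW H _ (fun b G => ~ spec_val G b) filtB.
  move=> G WG; have /asboolPn/existsNP[a /not_implyP[Fa Ga]] : ~~ (F <= G).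
    by apply/negP => FG; apply: FW; exists G.
  exists (~` spec_basic a, B a); first split.
  - apply: open_nbhs_nbhs; split=> //.
    by rewrite openC; exact: (spec_basic_clopen _).2.
  - by exists a.
  - move=> [K b] [/= Ka [Fb ba]] Kb; apply: Ka.
    exact: lfilterS (spec_prime K) _ _ ba Kb.
have oa := (spec_basic_clopen a).1.
apply: filterS (open_nbhs_nbhs (conj oa Fa)) => K Ka [G WG /asboolP KG].
by apply: (aW a _ G WG); [split|exact: KG].
Qed.

Definition Spec : esakiaSpace d := EsakiaSpace spec_esakia.

End Spec.

(* Main.v *)
Require Import Defs.
From HB Require Import structures.
From mathcomp Require Import all_boot all_order.
From mathcomp Require Import all_classical topology.

(** Let [X] be the spectrum of [H]. An object of [EsaEt X] is covered by finitely
    many clopen upsets, its charts, on each of which the projection to [X] is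
    injective, and a map over [X] is a morphism as soon as it pulls charts back
    to clopen upsets ([hom_charts]). Conversely any finite family of partial
    sections over clopen upsets of [X] that agree on clopen upsets can be glued
    to an object ([atlas], [realize]). So objects and morphisms can be built by
    giving sets of points over [X], and what has to be checked is that certain
    subsets are clopen upsets. Finite limits are then computed
    fibrewise ([EsaEt_finite_limits]).

    The three conditions meet in the following one ([finitely_tested]): there is
    a finite family [u] in [H] with [\join_i hiff x (u i) = \top] for all [x].
    Over [X] it says that above any point every clopen upset coincides with one
    of finitely many test sets.

    A finitely tested [H] gives a topos ([tested_topos]). The fibre of the
    exponential at [x] consists of germs at [x] of maps, that of the subobject
    classifier of the upsets of the set of points above [x]. Thanks to the test
    family a germ is described by a finite table of indices, and the tables serve
    as the finitely many sections of an atlas. That two tables describe the same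
    germ at [x] is a clopen condition imposed on all points above [x], hence a
    clopen upset since [X] is an Esakia space ([clopen_upset_box]).

    If [EsaEt X] is a topos, it is itself the topos required: charts are
    subterminal, monomorphisms are injective, so the subobjects of the terminal
    object are the clopen upsets of [X], which are the elements of [H]
    ([EsaEt_finitely_propositional], [EsaEt_subobjects]).

    In a finitely propositional topos a finite cover of the subobject classifier
    by subterminal objects yields a finite test family ([topos_tested]).

    Finally a finitely tested [H] is locally finite, because modulo any prime
    filter it has at most as many elements as the test family. So the test
    elements lie in a finite subalgebra, and its inclusion satisfies Jibladze's
    law ([tested_etale_finite]). *)

Set Implicit Arguments.
Unset Strict Implicit.
Unset Printing Implicit Defensive.

Import Order.TTheory.
Local Open Scope order_scope.
Local Open Scope classical_set_scope.

(** * Clopen sets and compactness *)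

(** A finite subcover argument without indices: a property of sets that is
    stable under finite unions and holds locally holds on some superset of a
    compact set. Otherwise the complements of the sets with the property
    generate a proper filter, and a cluster point of it contradicts locality. *)
Lemma compact_induction (T : topologicalType) (K : set T) (P : set T -> Prop) :
  compact K -> P set0 -> (forall A B, P A -> P B -> P (A `|` B)) ->
  (forall x, K x -> exists U, [/\ open U, U x & P U]) ->
  exists W, K `<=` W /\ P W.
Proof.
move=> cK P0 PU loc; apply: contrapT => nW.
pose F : set_system T := [set A | exists2 W, P W & K `\` W `<=` A].
have FF : ProperFilter F.
  split.
    move=> [W PW KW]; apply: nW; exists W; split=> // x Kx.
    by apply: contrapT => nWx; apply: (KW x).
  split; first by exists set0.
    move=> A B [V PV VA] [W PW WB]; exists (V `|` W); first exact: PU.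
    move=> x [Kx nVW]; split; [apply: VA|apply: WB]; split=> // ?; apply: nVW;
      by [left|right].
  by move=> A B AB [V PV VA]; exists V => //; exact: subset_trans AB.
have [|x [Kx xF]] := cK F FF; first by exists set0 => // x [].
have [U [oU Ux PU']] := loc x Kx.
have [|z [[Kz nUz] Uz]] // := xF (K `\` U) U _ (open_nbhs_nbhs (conj oU Ux)).
by exists U.
Qed.

Section ClopenFinite.
Variable T : topologicalType.

Lemma clopen_compl (A : set T) : clopen A -> clopen (~` A).
Proof. exact: (@clopenC T A A). Qed.

Lemma clopen_imply (A B : set T) :
  clopen A -> clopen B -> clopen [set x | A x -> B x].
Proof.
move=> cA cB; have -> : [set x | A x -> B x] = ~` A `|` B.
  apply/seteqP; split=> x /=; last by case.
  by move=> AB; have [Ax|] := pselect (A x); [right; exact: AB|left].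
by apply: clopenU => //; exact: clopen_compl.
Qed.

Lemma clopen_bigcup (I : finType) (F : I -> set T) :
  (forall i, clopen (F i)) -> clopen [set x | exists i, F i x].
Proof.
move=> cF; have -> : [set x | exists i, F i x] = \big[setU/set0]_(i : I) F i.
  by rewrite -bigcup_seq; apply/seteqP; split=> x [i]; exists i => //=; rewrite mem_index_enum.
by elim/big_ind: _ => //; [exact: clopen0|exact: clopenU].
Qed.

Lemma clopen_bigcap (I : finType) (F : I -> set T) :
  (forall i, clopen (F i)) -> clopen [set x | forall i, F i x].
Proof.
move=> cF; have -> : [set x | forall i, F i x] = ~` [set x | exists i, (~` F i) x].
  apply/seteqP; split=> x /= h; first by case=> i; apply.
  by move=> i; apply: contrapT => ?; apply: h; exists i.
by apply/clopen_compl/(@clopen_bigcup I (fun i => ~` F i)) => // i; exact: clopen_compl.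
Qed.

Lemma clopen_iff (A B : set T) :
  clopen A -> clopen B -> clopen [set x | A x <-> B x].
Proof.
move=> cA cB.
have -> : [set x | A x <-> B x] = [set x | A x -> B x] `&` [set x | B x -> A x] by [].
by apply: clopenI; exact: clopen_imply.
Qed.

Lemma clopen_bigcap_finite_type (I : Type) (F : I -> set T) : finite_type I ->
  (forall i, clopen (F i)) -> clopen [set x | forall i, F i x].
Proof.
move=> [J [e [g eK gK]]] cF.
have -> : [set x | forall i, F i x] = [set x | forall j, F (e j) x].
  by apply/seteqP; split=> x /= Fx i //; rewrite -(gK i).
by apply: clopen_bigcap.
Qed.

End ClopenFinite.

(** * Spectral local homeomorphisms of Priestley spaces *)

Lemma within_openP (S T : topologicalType) (A : set S) (f : S -> T) : open A ->
  {within A, continuous f} <-> forall O, open O -> open (A `&` f @^-1` O).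
Proof. by move=> oA; rewrite continuous_open_subspace //; exact: continuous_inP. Qed.

Section Etale.
Context {d : Order.disp_t}.
Implicit Types X Y Z : orderedSpace d.

(** The patch-topology form of a spectral local homeomorphism. Lifting makes the
    images of upsets upsets, so it is enough to ask that the images of the
    charts be open in the patch topology. *)
Definition etale Y X (f : Y -> X) : Prop :=
  [/\ continuous f, {homo f : x y / x <= y},
      (forall y x, f y <= x -> exists2 y', y <= y' & f y' = x) &
      forall y, exists V, [/\ clopen V, upset V, V y, set_inj V f & open (f @` V)]].

Lemma priestley_hausdorff X : priestley X -> hausdorff_space X.
Proof.
move=> [_ sep] x y xy.
suff le (a b : X) : (forall A B, nbhs a A -> nbhs b B -> A `&` B !=set0) -> a <= b.
  apply/eqP; rewrite eq_le !le //.
  by move=> A B nA nB; rewrite setIC; apply: xy.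
move=> ab; apply: contrapT => /negP/sep[U [[oU cU] _ Ua nUb]].
have [||z []] // := ab U (~` U); apply: open_nbhs_nbhs; split=> //.
by rewrite openC.
Qed.

(** Separate the point from each point of the compact complement of [O] by a
    clopen upset, then intersect finitely many of these. *)
Lemma open_upset_base X (O : set X) x : priestley X -> open O -> upset O -> O x ->
  exists V, [/\ clopen V, upset V, V x & V `<=` O].
Proof.
move=> [cX sep] oO uO Ox.
have cO : compact (~` O) by apply: subclosed_compact cX _; [rewrite closedC|].
have [||z nOz|W [OW [/= cW uW nWx]]] := @compact_induction X (~` O)
  [set W | [/\ clopen W, upset (~` W) & ~ W x]] cO.
- by split=> //; exact: clopen0.
- move=> A B [cA uA nA] [cB uB nB]; split; first exact: clopenU.
    by rewrite setCU => y z yz [Ay By]; split; [exact: uA Ay|exact: uB By].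
  by case.
- have /negP/sep[U [cU uU Ux nUz]] : ~ x <= z by move=> /uO/(_ Ox).
  exists (~` U); split=> //; first exact: (clopen_compl cU).1.
  by split; [exact: clopen_compl|rewrite setCK|apply].
exists (~` W); split=> //; first exact: clopen_compl.
by rewrite -[O]setCK; exact: subsetC.
Qed.

Lemma clopen_upset_compact X (V : set X) : priestley X -> clopen V -> compact V.
Proof. by move=> [cX _] [_ cV]; exact: subclosed_compact cV cX _. Qed.

Lemma spectral_open X (U : set X) : @open (spectral X) U = (open U /\ upset U).
Proof. by []. Qed.

Lemma upsetI X (U V : set X) : upset U -> upset V -> upset (U `&` V).
Proof. by move=> uU uV x y xy [Ux Vx]; split; [exact: uU Ux|exact: uV Vx]. Qed.

Lemma etale_upset_image Y X (f : Y -> X) (W : set Y) :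
  etale f -> upset W -> upset (f @` W).
Proof.
move=> [_ _ lift _] uW x z xz [y Wy fy]; subst x.
by have [y' yy' <-] := lift _ _ xz; exists y' => //; exact: uW Wy.
Qed.

Lemma etale_lift_unique Y X (f : Y -> X) y y1 y2 :
  etale f -> y <= y1 -> y <= y2 -> f y1 = f y2 -> y1 = y2.
Proof.
move=> [_ _ _ loc] y1P y2P f12; have [V [_ uV Vy inj _]] := loc y.
by apply: inj => //; rewrite inE; [exact: uV Vy|exact: uV Vy].
Qed.

Lemma etale_le_inj Y X (f : Y -> X) (V : set Y) y y' : etale f -> upset V -> set_inj V f ->
  V y -> V y' -> f y <= f y' -> y <= y'.
Proof.
move=> [_ _ lift _] uV inj Vy Vy' /lift[z yz fz].
by rewrite -(inj z y') ?inE //; exact: uV Vy.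
Qed.

Lemma closed_image Y X (f : Y -> X) (W : set Y) :
  priestley Y -> priestley X -> continuous f -> closed W -> closed (f @` W).
Proof.
move=> [cY _] pX cf cW; apply: compact_closed; first exact: priestley_hausdorff.
apply: continuous_compact; first exact: continuous_subspaceT.
exact: subclosed_compact cW cY _.
Qed.

(** Closedness is compactness. For openness, work inside a chart [V]: by
    injectivity, the image of the part of [W] in [V] is the open image of [V]
    minus the closed image of the rest of [V]. *)
Lemma etale_clopen_image Y X (f : Y -> X) (W : set Y) :
  priestley Y -> priestley X -> etale f -> clopen W -> clopen (f @` W).
Proof.
move=> pY pX [cf _ _ loc] [oW cW]; split; last exact: closed_image.
have [||||A [AT]] := @compact_induction Y setT (fun A => open (f @` (W `&` A))).
- exact: pY.1.
- by rewrite setI0 image_set0; exact: open0.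
- by move=> A B oA oB; rewrite setIUr image_setU; exact: openU.
- move=> y _; have [V [[oV cV] uV Vy inj ofV]] := loc y; exists V; split=> //.
  have -> : f @` (W `&` V) = f @` V `&` ~` (f @` (V `&` ~` W)).
    apply/seteqP; split=> [x [z [Wz Vz] <-]|x [[z Vz <-] nz]].
      by split; [exists z|case=> u [Vu nWu] uz; apply: nWu; rewrite (inj u z) ?inE].
    by exists z => //; split=> //; apply: contrapT => nWz; apply: nz; exists z.
  apply: openI => //; rewrite openC; apply: closed_image => //.
  by apply: closedI => //; rewrite closedC.
by have -> : A = setT by [apply/seteqP; split]; rewrite setIT.
Qed.

(** In a chart [V] the map reflects the order, so the downset of [W] within [V]
    is the preimage of the downset of the image of [W] within [V]. *)
Lemma etale_esakia Y X (f : Y -> X) : priestley Y -> esakia X -> etale f -> esakia Y.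
Proof.
move=> pY [pX eX] ef; split=> // W cW.
have [cf mf _ loc] := ef.
have [||||A [AT]] := @compact_induction Y setT (fun A => clopen (downclosure W `&` A)).
- exact: pY.1.
- by rewrite setI0; exact: clopen0.
- by move=> A B cA cB; rewrite setIUr; exact: clopenU.
- move=> y _; have [V [cV uV Vy inj _]] := loc y; exists V; split=> //; first exact: cV.1.
  have -> : downclosure W `&` V = V `&` f @^-1` downclosure (f @` (W `&` V)).
    apply/seteqP; split=> [z [[w Ww zw] Vz]|z [Vz [_ [w [Ww Vw] <-] zw]]].
      by split=> //; exists (f w); [exists w => //; split=> //; exact: uV Vz|exact: mf].
    by split=> //; exists w => //; exact: (etale_le_inj ef uV).
  apply: clopenI => //; apply: preimage_clopen => //; apply: eX.
  by apply: etale_clopen_image => //; exact: clopenI.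
by have -> : A = setT by [apply/seteqP; split]; rewrite setIT.
Qed.

Lemma etale_spectral Y X (f : Y -> X) : priestley Y -> priestley X ->
  etale f -> spectral_local_homeomorphism f.
Proof.
move=> pY pX ef y; have [cf mf lift loc] := ef.
have [V [cV uV Vy inj ofV]] := loc y.
have ofV' : @open (spectral X) (f @` V).
  by rewrite spectral_open; split=> //; exact: etale_upset_image.
have oV : @open (spectral Y) V by split=> //; exact: cV.1.
exists V; split=> //.
pose g (x : X) : Y := xget y [set z | V z /\ f z = x].
have gK z : V z -> g (f z) = z.
  move=> Vz; have [Vg fg] := xgetI y (conj Vz (erefl (f z)) : [set z' | V z' /\ f z' = f z] z).
  by apply: inj; rewrite ?inE.
exists g; split; first by move=> z; rewrite inE => /gK.
- apply: continuous_subspaceT; apply/continuousP => O [oO uO]; split.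
    by move/continuousP: cf; apply.
  by move=> a b /mf ab; exact: uO.
- apply/within_openP => // O [oO uO].
  have -> : f @` V `&` g @^-1` O = f @` V `&` ~` (f @` (V `&` ~` O)).
    apply/seteqP; split=> [x [[z Vz <-] /=]|x [[z Vz <-] nz]].
      rewrite gK // => Oz; split; first by exists z.
      by case=> u [Vu nOu] uz; apply: nOu; rewrite (inj u z) ?inE.
    split; first by exists z.
    by rewrite /= gK //; apply: contrapT => nO; apply: nz; exists z.
  split.
    apply: openI => //; rewrite openC; apply: closed_image => //.
    by apply: closedI; [exact: cV.2|rewrite closedC].
  move=> a b ab [[z Vz za] nz]; subst a; have [z' zz' <-] := lift _ _ ab.
  have Vz' := uV _ _ zz' Vz.
  split; first by exists z'.
  case=> u [Vu nOu] uz'; apply: nOu.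
  have -> : u = z' by apply: inj; rewrite ?inE.
  by apply: uO zz' _; apply: contrapT => nOz; apply: nz; exists z.
Qed.

(** Differences of clopen upsets form a base of the patch topology: separate
    the point from each point of the compact complement, on whichever side the
    order permits. *)
Lemma priestley_base X (O : set X) x : priestley X -> open O -> O x ->
  exists A B, [/\ clopen A /\ upset A, clopen B /\ upset B, A x, ~ B x & A `&` ~` B `<=` O].
Proof.
move=> [cX sep] oO Ox.
have cO : compact (~` O) by apply: subclosed_compact cX _; [rewrite closedC|].
have [||z nOz|W [OW [A [B [cA cB Ax nBx AB]]]]] := @compact_induction X (~` O)
  (fun W => exists A B, [/\ clopen A /\ upset A, clopen B /\ upset B, A x, ~ B x &
     A `&` ~` B `<=` ~` W]) cO.
- by exists setT, set0; split=> //; split=> //; [exact: clopenT|exact: clopen0].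
- move=> W W' [A [B [[cA uA] [cB uB] Ax nBx AB]]] [A' [B' [[cA' uA'] [cB' uB'] Ax' nBx' AB']]].
  exists (A `&` A'), (B `|` B'); split=> //.
  + by split; [exact: clopenI|exact: upsetI].
  + split; first exact: clopenU.
    by move=> y z yz [By|By]; [left; exact: uB By|right; exact: uB' By].
  + by case.
  + by move=> y [[Ay Ay'] nBy] [Wy|Wy]; [apply: (AB y)|apply: (AB' y)] => //;
       split=> // ?; apply: nBy; [left|right].
- have [xz|nxz] := pselect (x <= z); last first.
    have /negP/sep[U [cU uU Ux nUz]] := nxz.
    exists (~` U); split=> //; first exact: (clopen_compl cU).1.
    by exists U, set0; rewrite setCK; split=> //; [split=> //; exact: clopen0].
  have /negP/sep[U [cU uU Uz nUx]] : ~ z <= x.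
    by move=> zx; apply: nOz; have -> : z = x by apply/eqP; rewrite eq_le zx.
  exists U; split=> //; first exact: cU.1.
  by exists setT, U; split=> //; [split=> //; exact: clopenT].
by exists A, B; split=> //; apply: subset_trans AB _; rewrite -[O]setCK; exact: subsetC.
Qed.

(** The crux is that the preimage of a clopen upset [U] is clopen and not merely
    open. In a chart [V] small enough to be a clopen upset, the image of [V] is
    compact and hence clopen, and so is its intersection with [U]; carrying
    that compact set back along the inverse of the chart shows that the
    preimage of [U] within [V] is clopen. *)
Lemma spectral_etale Y X (f : Y -> X) : priestley Y -> priestley X ->
  spectral_local_homeomorphism f -> etale f.
Proof.
move=> pY pX lf.
(* a domain on which f is a homeomorphism is an open upset, so it shrinks to a
   clopen upset around the given point *)
have chart y : exists V g, [/\ clopen V, upset V, V y, {in V, cancel f g} &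
   [/\ open (f @` V), upset (f @` V),
      forall O, open O -> upset O -> open (V `&` f @^-1` O) /\ upset (V `&` f @^-1` O) &
      forall O, open O -> upset O -> O `<=` V ->
        open (f @` O) /\ upset (f @` O)]].
  have [U [oU Uy ofU [g [gK cf cg]]]] := lf y.
  have [V [cV uV Vy VU]] := open_upset_base pY oU.1 oU.2 Uy.
  have im O : open O -> upset O -> O `<=` V -> open (f @` O) /\ upset (f @` O).
    move=> oO uO OV.
    have h := (@within_openP (spectral X) (spectral Y) _ g ofU).1 cg O (conj oO uO).
    have -> : f @` O = f @` U `&` g @^-1` O; last exact: h.
    apply/seteqP; split=> [x [z Oz <-]|x [[z Uz <-] /= ]].
      have Uz : U z by apply/VU/OV.
      by split; [exists z|rewrite /= gK ?inE].
    by rewrite gK ?inE //; exists z.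
  exists V, g; split=> //; first by move=> z; rewrite inE => /VU Uz; rewrite gK ?inE.
  split=> //.
  - by apply: (im V _ _ _).1 => //; exact: cV.1.
  - by apply: (im V _ _ _).2 => //; exact: cV.1.
  move=> O oO uO.
  have [h1 h2] := (@within_openP (spectral Y) (spectral X) _ f oU).1 cf O (conj oO uO).
  have -> : V `&` f @^-1` O = V `&` (U `&` f @^-1` O).
    by rewrite setIA (setIidl VU).
  by split; [apply: openI => //; exact: cV.1|exact: upsetI].
have imV y : exists V, [/\ clopen V, upset V, V y, set_inj V f &
    [/\ open (f @` V), upset (f @` V) &
      forall U, clopen U -> upset U -> clopen (V `&` f @^-1` U)]].
  have [V [g [cV uV Vy gK [ofV ufV pre im]]]] := chart y.
  have inj : set_inj V f by move=> a b aV bV fab; rewrite -(gK a) // -(gK b) // fab.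
  exists V; split=> //; split=> // U cU uU.
  have cfV : clopen (f @` V).
    have [||z Vz|A [VA [B [cB uB BV AB]]]] := @compact_induction Y V
      (fun A => exists B, [/\ clopen B, upset B, B `<=` f @` V & V `&` A `<=` f @^-1` B])
      (clopen_upset_compact pY cV).
    - by exists set0; rewrite setI0; split=> //; exact: clopen0.
    - move=> A A' [B [cB uB BV AB]] [B' [cB' uB' BV' AB']]; exists (B `|` B'); split.
      + exact: clopenU.
      + by move=> a b ab [Ba|Ba]; [left; exact: uB Ba|right; exact: uB' Ba].
      + by move=> x [/BV|/BV'].
      + by move=> x [Vx [Ax|Ax]]; [left; exact: AB|right; exact: AB'].
    - have [B [cB uB Bz BV]] := open_upset_base pX ofV ufV (imageP f Vz).
      exists (V `&` f @^-1` B); split=> //; last by exists B; split=> // x [_ []].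
      by apply: (pre _ _ _).1 => //; exact: cB.1.
    have -> // : f @` V = B.
    by apply/seteqP; split=> // x [z Vz <-]; apply: AB; split=> //; exact: VA.
  have [oP uP] := pre U cU.1 uU.
  have [||x [[z Vz zx] Ux]|A [QA [B [cB uB BV AB]]]] := @compact_induction X (f @` V `&` U)
    (fun A => exists B, [/\ clopen B, upset B, B `<=` V `&` f @^-1` U &
       f @` V `&` U `&` A `<=` f @` B])
    (clopen_upset_compact pX (clopenI cfV cU)).
  - by exists set0; rewrite setI0; split=> //; exact: clopen0.
  - move=> A A' [B [cB uB BV AB]] [B' [cB' uB' BV' AB']]; exists (B `|` B'); split.
    + exact: clopenU.
    + by move=> a b ab [Ba|Ba]; [left; exact: uB Ba|right; exact: uB' Ba].
    + by move=> x [/BV|/BV'].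
    + by rewrite image_setU => x [Vx [Ax|Ax]]; [left; exact: AB|right; exact: AB'].
  - subst x; have [B [cB uB Bz BV]] := open_upset_base pY oP uP (conj Vz Ux).
    exists (f @` B); split; [|by exists z|by exists B; split=> // x []].
    by apply: (im B cB.1 uB _).1 => x /BV[].
  have -> // : V `&` f @^-1` U = B.
  apply/seteqP; split=> // x [Vx Ux].
  have [|u Bu ufx] := AB (f x).
    by split; [split; [exists x|]|apply: QA; split; [exists x|]].
  by have <- : u = x by apply: inj => //; rewrite inE //; exact: (BV _ Bu).1.
have prec U : clopen U -> upset U -> clopen (f @^-1` U).
  move=> cU uU; split.
    rewrite openE => y Uy; have [V [_ _ Vy _ [_ _ h]]] := imV y.
    have [oh _] := h U cU uU.
    by apply: filterS (open_nbhs_nbhs (conj oh (conj Vy Uy))) => z [].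
  rewrite -openC openE => y Uy; have [V [cV _ Vy _ [_ _ h]]] := imV y.
  have /clopen_compl[oh _] := h U cU uU.
  have oW : open (V `&` ~` (V `&` f @^-1` U)) by apply: openI => //; exact: cV.1.
  have Wy : (V `&` ~` (V `&` f @^-1` U)) y by split=> // -[].
  by apply: filterS (open_nbhs_nbhs (conj oW Wy)) => z [Vz nz] Uz; apply: nz.
have mf : {homo f : x y / x <= y}.
  move=> y y' yy'; apply: contrapT => /negP/pX.2[U [cU uU Uy nUy']].
  have [V [g [cV uV Vy gK [ofV ufV pre im]]]] := chart y.
  have [_ uP] := pre U cU.1 uU.
  by have [] := uP y y' yy' (conj Vy Uy).
split=> //.
- apply/continuousP => O oO; rewrite openE => y Oy.
  have [A [B [[cA uA] [cB uB] Ay nBy AB]]] := priestley_base pX oO Oy.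
  have oW : open (f @^-1` A `&` ~` (f @^-1` B)).
    by apply: openI; [exact: (prec A cA uA).1|exact: (clopen_compl (prec B cB uB)).1].
  by apply: filterS (open_nbhs_nbhs (conj oW (conj Ay nBy))) => z [Az nBz]; exact: AB.
- move=> y x fyx; have [V [g [cV uV Vy gK [ofV ufV pre im]]]] := chart y.
  have [y' Vy' y'x] := ufV _ _ fyx (imageP f Vy).
  exists y' => //; apply: contrapT => /negP/pY.2[U [[oU _] uU Uy nUy']].
  have [|||u [Uu Vu] ux] := (im (U `&` V) _ _ _).2 _ _ fyx (imageP f (conj Uy Vy)).
  + by apply: openI => //; exact: cV.1.
  + exact: upsetI.
  + by move=> z [].
  by apply: nUy'; rewrite -(gK y') ?inE // y'x -ux gK ?inE.
- by move=> y; have [V [cV uV Vy inj [ofV _ _]]] := imV y; exists V.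
Qed.

(** Between spaces that are etale over [X], a map over [X] only has to be
    continuous and monotone: charts and lifts come from [X]. *)
Lemma etale_over X Y Z (f : Y -> X) (g : Z -> X) (h : Y -> Z) :
  priestley Y -> priestley X -> etale f -> etale g -> continuous h -> {homo h : x y / x <= y} ->
  (forall y, g (h y) = f y) -> etale h.
Proof.
move=> pY pX ef eg ch mh gh; have [cf mf lf locf] := ef; have [cg mg lg locg] := eg.
split=> //.
  move=> y z hyz; have fyz : f y <= g z by rewrite -gh; exact: mg.
  have [y' yy' fy'] := lf _ _ fyz; exists y' => //.
  by apply: (etale_lift_unique eg (mh _ _ yy') hyz); rewrite gh.
move=> y; have [V [cV uV Vy injV ofV]] := locf y.
have [W [cW uW Wy injW ogW]] := locg (h y).
have cU : clopen (V `&` h @^-1` W) by apply: clopenI => //; exact: preimage_clopen.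
exists (V `&` h @^-1` W); split=> //.
- by apply: upsetI => // a b /mh; exact: uW.
- move=> a b /[!inE] -[Va _] [Vb _] hab; apply: injV; rewrite ?inE //.
  by rewrite -!gh hab.
- have -> : h @` (V `&` h @^-1` W) = W `&` g @^-1` (f @` (V `&` h @^-1` W)).
    apply/seteqP; split=> [z [a [Va Wa] <-]|z [Wz [a [Va Wa] fa]]].
      by split=> //=; exists a.
    by exists a => //; apply: injW; rewrite ?inE // gh fa.
  apply: openI; first exact: cW.1.
  by move/continuousP: cg; apply; exact: (etale_clopen_image pY pX ef cU).1.
Qed.
End Etale.

(** * Spaces glued from finitely many partial sections *)

Section Realization.
Context {d : Order.disp_t} (X : esakiaSpace d).

(** A set over [X] covered by finitely many partial sections, each given by its
    image [at_mem a]. The locus where two sections agree is a clopen upset,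
    which is all that is needed to glue their domains into an Esakia space. *)
Record atlas := Atlas {
  at_pt : Type;
  at_map : at_pt -> X;
  at_idx : finType;
  at_mem : at_idx -> set at_pt;
  at_cover : forall y, exists a, at_mem a y;
  at_inj : forall a y y', at_mem a y -> at_mem a y' -> at_map y = at_map y' -> y = y';
  at_clopen : forall a b, clopen (at_map @` (at_mem a `&` at_mem b));
  at_upset : forall a b, upset (at_map @` (at_mem a `&` at_mem b))
}.

Definition realize (K : atlas) : Type := at_pt K.

Variable K : atlas.
Local Notation T := (realize K).
Let f : T -> X := @at_map K.
Let m (a : at_idx K) : set T := @at_mem K a.

HB.instance Definition _ := gen_eqMixin T.
HB.instance Definition _ := gen_choiceMixin T.

(** A point lies below another when it restricts to it: it sits over a smaller
    point, and every section through it passes through the other one. *)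
Definition realize_le (y z : T) : bool :=
  `[< f y <= f z /\ forall a, m a y -> m a z >].

Let le_refl : reflexive realize_le. Proof. by move=> y; apply/asboolP. Qed.

Let le_anti : antisymmetric realize_le.
Proof.
move=> y z /andP[/asboolP[yz myz] /asboolP[zy mzy]].
have [a ay] := at_cover y; apply: (at_inj ay); first exact: myz.
by apply/eqP; rewrite eq_le yz zy.
Qed.

Let le_trans : transitive realize_le.
Proof.
move=> z y w /asboolP[yz myz] /asboolP[zw mzw]; apply/asboolP.
by split; [exact: le_trans zw|move=> a /myz /mzw].
Qed.

HB.instance Definition _ :=
  Order.Le_isPOrder.Build d T le_refl le_anti le_trans.

(** The topology induced from [X] times the discrete space of sets of indices,
    a point being sent to its base point and to the set of sections through
    it. *)
Definition realize_open (W : set T) : Prop := forall y, W y ->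
  exists O : set X, [/\ open O, O (f y) &
    forall z, O (f z) -> (forall a, m a y <-> m a z) -> W z].

Let opT : realize_open setT.
Proof. by move=> y _; exists setT; split=> //; exact: openT. Qed.

Let opI : setI_closed realize_open.
Proof.
move=> A B oA oB y [Ay By]; have [O [oO Oy OA]] := oA y Ay.
have [P [oP Py PB]] := oB y By; exists (O `&` P); split=> //; first exact: openI.
by move=> z [Oz Pz] yz; split; [exact: OA|exact: PB].
Qed.

Let op_bigU (I : Type) (F : I -> set T) :
  (forall i, realize_open (F i)) -> realize_open (\bigcup_i F i).
Proof.
move=> oF y [i _ Fy]; have [O [oO Oy OF]] := oF i y Fy.
by exists O; split=> // z Oz yz; exists i => //; exact: OF.
Qed.

HB.instance Definition _ := isOpenTopological.Build T opT opI op_bigU.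

Lemma realize_openE (W : set T) : open W = realize_open W.
Proof. by []. Qed.

Lemma realize_continuous : continuous f.
Proof. by apply/continuousP => O oO; rewrite realize_openE => y Oy; exists O. Qed.

Lemma realize_le_map : {homo f : y z / y <= z}.
Proof. by move=> y z /asboolP[]. Qed.

Lemma realize_mem_clopen a : clopen (m a).
Proof.
split; [|rewrite -openC]; rewrite realize_openE => y ay.
  by exists setT; split=> // [|z _ h]; [exact: openT|exact/h].
by exists setT; split=> // [|z _ h]; [exact: openT|rewrite /setC /= -h].
Qed.

Lemma realize_mem_upset a : upset (m a).
Proof. by move=> y z /asboolP[_]; exact. Qed.

Lemma realize_le_mem a y z : m a y -> m a z -> f y <= f z -> y <= z.
Proof.
move=> ay az yz; apply/asboolP; split=> // b by_.
have [//|w [aw bw] wz] := @at_upset K a b _ _ yz.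
  by exists y.
by have -> : z = w by apply: (at_inj az aw).
Qed.

Lemma realize_open_mem (W : set T) y : open W -> W y ->
  exists O, [/\ open O, O (f y) & forall z, O (f z) -> (forall a, m a y <-> m a z) -> W z].
Proof. by rewrite realize_openE; exact. Qed.

(** An ultrafilter contains one of the finitely many sections, and its image in
    [X] clusters at some point [x]; it then converges to the point over [x] in
    that section. *)
Lemma realize_compact : compact [set: T].
Proof.
rewrite compact_ultra => U UU _.
have [a Ua] : exists a, U (m a).
  apply: contrapT => nU.
  have : U [set y | forall a, ~ m a y].
    apply: filter_forall => a.
    by have [Ua|//] := in_ultra_setVsetC (m a) UU; case: nU; exists a.
  by move=> /filter_ex[y ny]; have [a /ny] := at_cover y.
have [cX _] := (esakiaP X).1.
have [x [_ Ux]] := cX (f @ U) _ filterT.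
have im b c : closed (f @` (m b `&` m c)) := (at_clopen b c).2.
have fU (A : set X) : open A -> A x -> U (f @^-1` A).
  move=> oA Ax; have [//|nA] := in_ultra_setVsetC (f @^-1` A) UU.
  by have [z []] := Ux (~` A) A nA (open_nbhs_nbhs (conj oA Ax)).
have [y [ay _] yx] : (f @` (m a `&` m a)) x.
  apply: contrapT => nx.
  have := fU _ (closed_openC (im a a)) nx => Un.
  have /filter_ex[z [az]] : U (m a `&` f @^-1` (~` (f @` (m a `&` m a)))) by exact: filterI.
  apply.
  by exists z.
exists y; split=> // W; rewrite nbhsE => -[B [oB By] BW]; apply: filterS BW _.
have [O [oO Oy OB]] := realize_open_mem oB By.
have Uall : U [set z | forall b, m b y <-> m b z].
  apply: filter_forall => b; have [by_|nby] := pselect (m b y).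
    have xb : (f @` (m a `&` m b)) x by exists y.
    apply: filterS (filterI Ua (fU _ (at_clopen a b).1 xb)) => z [az [w [aw bw] wz]].
    by split=> // _; have <- : w = z by exact: (at_inj aw az).
  have nxb : (~` (f @` (m a `&` m b))) x.
    move=> [w [aw bw] wx]; apply: nby; have <- // : w = y.
    by apply: (at_inj aw ay); exact: etrans wx (esym yx).
  apply: filterS (filterI Ua (fU _ (closed_openC (im a b)) nxb)) => z [az nz].
  by split=> // bz; case: nz; exists z.
apply: filterS (filterI Uall (fU O oO _)) => [z [mz Oz]|]; first exact: OB.
by rewrite -yx.
Qed.

Lemma realize_priestley : priestley T.
Proof.
split; first exact: realize_compact.
move=> y z /negP yz; have [fyz|/negP nfyz] := pselect (f y <= f z).
  have [a ay] := at_cover y; exists (m a); split=> //.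
  - exact: realize_mem_clopen.
  - exact: realize_mem_upset.
  - by move=> az; apply: yz; exact: (realize_le_mem ay).
have [U [cU uU Uy nUz]] := (esakiaP X).1.2 _ _ nfyz.
exists (f @^-1` U); split=> //.
- by apply: preimage_clopen => //; exact: realize_continuous.
- by move=> a b /realize_le_map; exact: uU.
Qed.

Lemma realize_etale : etale f.
Proof.
split; [exact: realize_continuous|exact: realize_le_map| |].
  move=> y x fyx; have [a ay] := at_cover y.
  have [|z [az _] zx] := @at_upset K a a _ _ fyx; first by exists y.
  by exists z => //; apply: (realize_le_mem ay az); rewrite -zx in fyx.
move=> y; have [a ay] := at_cover y; exists (m a); split=> //.
- exact: realize_mem_clopen.
- exact: realize_mem_upset.
- by move=> u v /[!inE] au av; exact: (at_inj au av).
- by have := (@at_clopen K a a).1; rewrite setIid.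
Qed.

Lemma realize_esakia : esakia T.
Proof. exact: etale_esakia realize_priestley (esakiaP X) realize_etale. Qed.

End Realization.

Lemma sval_inj (T : Type) (P : T -> Prop) : injective (@sval T P).
Proof. by case=> x px [y py] /= xy; exact: eq_exist. Qed.

Lemma choice_dep (I : Type) (T : I -> Type) (P : forall i, T i -> Prop) :
  (forall i, exists y, P i y) -> exists f : forall i, T i, forall i, P i (f i).
Proof. by move=> h; exists (fun i => projT1 (cid (h i))) => i; exact: projT2 (cid _). Qed.

Definition clopen_upset d (X : orderedSpace d) (U : set X) := clopen U /\ upset U.

Section ClopenUpset.
Context {d : Order.disp_t}.
Implicit Types X Y : orderedSpace d.

Lemma clopen_upsetT X : clopen_upset [set: X].
Proof. by split => //; exact: clopenT. Qed.

Lemma clopen_upsetI X (U V : set X) :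
  clopen_upset U -> clopen_upset V -> clopen_upset (U `&` V).
Proof. by move=> [cU uU] [cV uV]; split; [exact: clopenI|exact: upsetI]. Qed.

Lemma clopen_upset_bigcup X (I : finType) (F : I -> set X) :
  (forall i, clopen_upset (F i)) -> clopen_upset [set x | exists i, F i x].
Proof.
move=> cF; split; first by apply: clopen_bigcup => i; exact: (cF i).1.
by move=> x y xy [i Fx]; exists i; exact: (cF i).2 Fx.
Qed.

Lemma clopen_upset_bigcap X (I : Type) (F : I -> set X) : finite_type I ->
  (forall i, clopen_upset (F i)) -> clopen_upset [set x | forall i, F i x].
Proof.
move=> fI cF; split; first by apply: clopen_bigcap_finite_type => // i; exact: (cF i).1.
by move=> x y xy Fx i; exact: (cF i).2 (Fx i).
Qed.

Lemma clopen_upset_image Y X (f : Y -> X) (U : set Y) : priestley Y -> priestley X ->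
  etale f -> clopen_upset U -> clopen_upset (f @` U).
Proof.
by move=> pY pX ef [cU uU]; split; [exact: etale_clopen_image|exact: etale_upset_image].
Qed.

Lemma clopen_upset_preimage Y X (f : Y -> X) (U : set X) :
  etale f -> clopen_upset U -> clopen_upset (f @^-1` U).
Proof.
move=> [cf mf _ _] [cU uU]; split; first exact: preimage_clopen.
by move=> a b /mf; exact: uU.
Qed.

(** Kripke necessity. On an Esakia space it turns clopen sets into clopen
    upsets, which is how conditions on all restrictions of a point are shown
    to define clopen upsets. *)
Definition box X (Q : set X) : set X := [set x | forall y, x <= y -> Q y].

Lemma clopen_upset_box X (Q : set X) : esakia X -> clopen Q -> clopen_upset (box Q).
Proof.
move=> [_ eX] cQ; split.
  have -> : box Q = ~` downclosure (~` Q).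
    apply/seteqP; split=> [x Qx [y nQy xy]|x nx y xy]; first exact: nQy (Qx y xy).
    by apply: contrapT => nQy; apply: nx; exists y.
  by apply: clopen_compl; apply: eX; exact: clopen_compl.
by move=> x y xy Qx z yz; apply: Qx; exact: le_trans yz.
Qed.

End ClopenUpset.

(** * The slice category in terms of points *)

Lemma finite_type_fin (I : finType) : finite_type I.
Proof. by exists I, id; exists id. Qed.

Section EtaleObjects.
Context {d : Order.disp_t} (X : esakiaSpace d).
Local Notation Et := (EsaEt X).

Definition space (Y : Et) : esakiaSpace d := @sl_ob (EsaLH d) X Y.
Definition base (Y : Et) : space Y -> X := @esakia_fun d _ _ (sl_map Y).
Definition fn (Y Z : Et) (f : hom Y Z) : space Y -> space Z :=
  @esakia_fun d _ _ (sl_hom f).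

Implicit Types Y Z T : Et.

Lemma space_priestley Y : priestley (space Y).
Proof. exact: (esakiaP (space Y)).1. Qed.

Lemma base_etale Y : etale (@base Y).
Proof.
by apply: spectral_etale; [exact: space_priestley|exact: (esakiaP X).1|exact: esakia_funP].
Qed.

Lemma fn_etale Y Z (f : hom Y Z) : etale (fn f).
Proof.
by apply: spectral_etale; [exact: space_priestley|exact: space_priestley|exact: esakia_funP].
Qed.

Lemma fn_base Y Z (f : hom Y Z) y : base (fn f y) = base y.
Proof. by have := congr1 (fun h => @esakia_fun d _ _ h y) (sl_homP f). Qed.

Lemma fn_comp Y Z T (g : hom Z T) (f : hom Y Z) y : fn (g \oc f) y = fn g (fn f y).
Proof. by []. Qed.

Lemma fn_id Y y : fn (idm Y) y = y.
Proof. by []. Qed.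

Lemma hom_ext Y Z (f g : hom Y Z) : (forall y, fn f y = fn g y) -> f = g.
Proof. by move=> fg; apply/slice_hom_eq/esakia_hom_eq/funext. Qed.

Lemma fn_homo Y Z (f : hom Y Z) y y' : y <= y' -> fn f y <= fn f y'.
Proof. by have [_ mf _ _] := fn_etale f; exact: mf. Qed.

Lemma base_homo Y (y y' : space Y) : y <= y' -> base y <= base y'.
Proof. by have [_ mf _ _] := base_etale Y; exact: mf. Qed.

Lemma base_lift Y (y : space Y) x : base y <= x -> exists2 y', y <= y' & base y' = x.
Proof. by have [_ _ lf _] := base_etale Y; exact: lf. Qed.

Lemma base_lift_unique Y (y y1 y2 : space Y) :
  y <= y1 -> y <= y2 -> base y1 = base y2 -> y1 = y2.
Proof. exact: etale_lift_unique (base_etale Y). Qed.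

Lemma image_fn Y Z (f : hom Y Z) U : clopen_upset U -> clopen_upset (fn f @` U).
Proof. by apply: clopen_upset_image; [exact: space_priestley..|exact: fn_etale]. Qed.

Lemma image_base Y (U : set (space Y)) : clopen_upset U -> clopen_upset (@base Y @` U).
Proof.
by apply: clopen_upset_image; [exact: space_priestley|exact: (esakiaP X).1|exact: base_etale].
Qed.

Lemma preimage_fn Y Z (f : hom Y Z) U : clopen_upset U -> clopen_upset (fn f @^-1` U).
Proof. exact: clopen_upset_preimage (fn_etale f). Qed.

Lemma preimage_base Y U : clopen_upset U -> clopen_upset (@base Y @^-1` U).
Proof. exact: clopen_upset_preimage (base_etale Y). Qed.

Definition chart Y (V : set (space Y)) : Prop := clopen_upset V /\ set_inj V (@base Y).

Lemma chart_eq Y (V : set (space Y)) y y' : chart V -> V y -> V y' ->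
  base y = base y' -> y = y'.
Proof. by move=> [_ inj] Vy Vy'; apply: inj; rewrite inE. Qed.

Lemma chart_le Y (V : set (space Y)) y y' : chart V -> V y -> V y' ->
  base y <= base y' -> y <= y'.
Proof. by move=> [[_ uV] inj]; exact: etale_le_inj (base_etale Y) uV inj. Qed.

Lemma chart_cover Y : exists (A : finType) (V : A -> set (space Y)),
  (forall a, chart (V a)) /\ forall y, exists a, V a y.
Proof.
have [||||W [WT [A [V [cV VW]]]]] := @compact_induction (space Y) setT
   (fun W => exists (A : finType) (V : A -> set (space Y)),
     (forall a, chart (V a)) /\ [set y | exists a, V a y] = W).
- exact: (space_priestley Y).1.
- by exists void, (fun=> setT); split=> [[]|]; apply/seteqP; split=> y [].
- move=> _ _ [A [V [cV <-]]] [B [W [cW <-]]].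
  exists (A + B)%type, (fun c => match c with inl a => V a | inr b => W b end).
  split=> [[a|b]//|]; apply/seteqP; split=> [y [[a|b] h]|y [[a h]|[b h]]].
  + by left; exists a.
  + by right; exists b.
  + by exists (inl a).
  + by exists (inr b).
- move=> y _; have [_ _ _ /(_ y)[V [cV uV Vy inj _]]] := base_etale Y.
  exists V; split=> //; first exact: cV.1.
  exists unit, (fun=> V); split; first by [].
  by apply/seteqP; split=> [z []|z Vz] //; exists tt.
by exists A, V; split=> // y; rewrite -VW in WT; exact: (WT y).
Qed.

(** The criterion by which morphisms are built below. Inside a chart the map
    is determined by base points, so continuity and monotonicity follow from
    those of the projection to [X]. *)
Lemma hom_charts Z Y (A : Type) (V : A -> set (space Y)) (h : space Z -> space Y) :
  (forall a, chart (V a)) -> (forall y, exists a, V a y) ->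
  (forall z, base (h z) = base z) -> (forall a, clopen_upset (h @^-1` V a)) ->
  exists f : hom Z Y, fn f = h.
Proof.
move=> cV VT hb cuh.
have ch : continuous h.
  apply/continuousP => O oO; rewrite openE => z Oz; have [a Va] := VT (h z).
  have [[[oV _] _] _] := cV a.
  pose B := @base Y @` V a `&` ~` (@base Y @` (V a `&` ~` O)).
  have oB : open B.
    apply: openI; first exact: (image_base (cV a).1).1.1.
    rewrite openC; apply: closed_image.
    - exact: space_priestley.
    - exact: (esakiaP X).1.
    - by have [] := base_etale Y.
    - by apply: closedI; [exact: (cV a).1.1.2|rewrite closedC].
  have [cb _ _ _] := base_etale Z.
  have oC : open (h @^-1` V a `&` @base Z @^-1` B).
    by apply: openI; [exact: (cuh a).1.1|move/continuousP: cb; exact].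
  have Cz : (h @^-1` V a `&` @base Z @^-1` B) z.
    split=> //; split; first by exists (h z).
    case=> y [Vy nOy] yz; apply: nOy.
    by have -> : y = h z by apply: (chart_eq (cV a)); rewrite // hb.
  apply: filterS (open_nbhs_nbhs (conj oC Cz)) => w [Vw [_ nB]].
  by apply: contrapT => nOw; apply: nB; exists (h w).
have mh : {homo h : x y / x <= y}.
  move=> z z' zz'; have [a Va] := VT (h z).
  apply: (chart_le (cV a)) => //; first exact: (cuh a).2 zz' Va.
  by rewrite !hb; exact: base_homo.
have eh : etale h.
  apply: (etale_over (space_priestley Z) (esakiaP X).1 (base_etale Z) (base_etale Y)) => //.
have sh := etale_spectral (space_priestley Z) (space_priestley Y) eh.
pose f0 : @hom (EsaLH d) (space Z) (space Y) := @EsakiaHom d _ _ h sh.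
have f0P : sl_map Y \oc f0 = sl_map Z by apply/esakia_hom_eq/funext => z; exact: hb.
by exists (SliceHom f0P).
Qed.

Definition atlas_object (K : atlas X) : Et :=
  @SliceOb (EsaLH d) X (EsakiaSpace (realize_esakia K))
   (@EsakiaHom d (EsakiaSpace (realize_esakia K)) X (@at_map d X K)
     (etale_spectral (realize_priestley K) (esakiaP X).1 (realize_etale K))).

Lemma atlas_chart (K : atlas X) (a : at_idx K) :
  @chart (atlas_object K) (@at_mem d X K a).
Proof.
split; first by split; [exact: realize_mem_clopen|exact: realize_mem_upset].
by move=> y z /[!inE]; exact: at_inj.
Qed.

Lemma hom_atlas Z (K : atlas X) (h : space Z -> at_pt K) :
  (forall z, at_map (h z) = base z) ->
  (forall a, clopen_upset (h @^-1` @at_mem d X K a)) ->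
  exists f : hom Z (atlas_object K), fn f = h.
Proof. by move=> hb; apply: (hom_charts (@atlas_chart K) (@at_cover d X K)). Qed.

Lemma atlas_hom Y (K : atlas X) (h : at_pt K -> space Y) (A : Type) (V : A -> set (space Y)) :
  (forall a, chart (V a)) -> (forall y, exists a, V a y) ->
  (forall z, base (h z) = at_map z) -> (forall a, clopen_upset (h @^-1` V a : set (realize K))) ->
  exists f : hom (atlas_object K) Y, fn f = h.
Proof. by move=> cV VT hb cuh; exact: (@hom_charts (atlas_object K) Y A V h). Qed.

(** The unique pointwise factorization is a morphism, because it pulls a chart
    back to the preimage of its image. *)
Lemma hom_factor Z S Y (i : hom S Y) (g : hom Z Y) : injective (fn i) ->
  (forall z, exists s, fn i s = fn g z) -> exists h : hom Z S, i \oc h = g.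
Proof.
move=> inj /choice[h hP].
have [A [V [cV VT]]] := chart_cover S.
have [||f fh] := @hom_charts Z S A V h cV VT.
- by move=> z; rewrite -(fn_base i) hP fn_base.
- move=> a; have -> : h @^-1` V a = fn g @^-1` (fn i @` V a).
    apply/seteqP; split=> z /=; first by exists (h z).
    by case=> s Vs; rewrite -hP => /inj <-.
  by apply: preimage_fn; apply: image_fn; exact: (cV a).1.
by exists f; apply: hom_ext => z; rewrite fn_comp fh hP.
Qed.

End EtaleObjects.

(** * Products, subobjects and finite limits *)

Section Constructions.
Context {d : Order.disp_t} (X : esakiaSpace d).
Local Notation Et := (EsaEt X).
Implicit Types Y Z T : Et.

Lemma restriction Y (U : set (space Y)) : clopen_upset U ->
  exists (S : Et) (i : hom S Y), injective (fn i) /\ range (fn i) = U.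
Proof.
move=> cU; have [A [V [cV VT]]] := chart_cover Y.
pose pt := {y : space Y | U y}; pose mem a : set pt := fun y => V a (sval y).
have im a b : clopen_upset ((fun y : pt => base (sval y)) @` (mem a `&` mem b)).
  have -> : (fun y : pt => base (sval y)) @` (mem a `&` mem b) =
            @base d X Y @` (V a `&` V b `&` U).
    apply/seteqP; split=> [x [[y Uy] [ay by_] <-]|x [y [[ay by_] Uy] <-]]; first by exists y.
    by exists (exist _ y Uy).
  by apply: image_base; apply: clopen_upsetI => //; apply: clopen_upsetI; exact: (cV _).1.
have inj a (y y' : pt) : mem a y -> mem a y' -> base (sval y) = base (sval y') -> y = y'.
  by move=> ay ay' yy'; apply/sval_inj/(chart_eq (cV a) ay ay').
pose K := @Atlas d X pt (fun y => base (sval y)) A mem (fun y => VT (sval y)) inj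
  (fun a b => (im a b).1) (fun a b => (im a b).2).
have [||i iE] := @atlas_hom d X Y K (fun y => sval y) A V cV VT; first by [].
  by move=> a; exact: (@atlas_chart d X K a).1.
exists (atlas_object K), i; rewrite iE; split; first by exact: sval_inj.
apply/seteqP; split=> [y [[z Uz] _ <-]//|y Uy].
by exists (exist _ y Uy).
Qed.

(** Products of the slice are fibre products of the underlying sets; the two
    lemmas that compare this with [is_product] reduce the universal property of
    exponentials to statements about points. *)
Definition pointwise_product Y Z P (p1 : hom P Y) (p2 : hom P Z) : Prop :=
  (forall t t', fn p1 t = fn p1 t' -> fn p2 t = fn p2 t' -> t = t') /\
  (forall y z, base y = base z -> exists t, fn p1 t = y /\ fn p2 t = z).

Lemma pointwise_product_exists Y Z : exists (P : Et) (p1 : hom P Y) (p2 : hom P Z),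
  pointwise_product p1 p2.
Proof.
have [A [V [cV VT]]] := chart_cover Y; have [B [W [cW WT]]] := chart_cover Z.
pose pt := {yz : space Y * space Z | base yz.1 = base yz.2}.
pose mem (ab : A * B) : set pt := fun t => V ab.1 (sval t).1 /\ W ab.2 (sval t).2.
pose f (t : pt) := base (sval t).1.
have cov t : exists ab, mem ab t.
  by have [a ?] := VT (sval t).1; have [b ?] := WT (sval t).2; exists (a, b).
have im ab ab' : clopen_upset (f @` (mem ab `&` mem ab')).
  have -> : f @` (mem ab `&` mem ab') =
    @base d X Y @` (V ab.1 `&` V ab'.1) `&` @base d X Z @` (W ab.2 `&` W ab'.2).
    apply/seteqP; split=> [x [[[y z] /= yz] [[/= ? ?] [/= ? ?]] <-]|].
      by split; [exists y|exists z].
    move=> x [[y [Vy V'y] yx] [z [Wz W'z] zx]]; have yz : base y = base z by rewrite yx.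
    by exists (exist _ (y, z) yz).
  apply: clopen_upsetI; apply: image_base; apply: clopen_upsetI.
  - exact: (cV _).1.
  - exact: (cV _).1.
  - exact: (cW _).1.
  - exact: (cW _).1.
have inj ab t t' : mem ab t -> mem ab t' -> f t = f t' -> t = t'.
  case: t t' => [[y z] /= yz] [[y' z'] /= yz'] [/= ay bz] [/= ay' bz'] tt'; apply: eq_exist.
  congr (_, _); first exact: (chart_eq (cV _) ay ay').
  by apply: (chart_eq (cW _) bz bz'); rewrite -yz -yz'.
pose K := @Atlas d X pt f (A * B)%type mem cov inj
  (fun a b => (im a b).1) (fun a b => (im a b).2).
have ck (ab : A * B) : clopen_upset (mem ab : set (realize K)).
  exact: (@atlas_chart d X K ab).1.
have [||p1 p1E] := @atlas_hom d X Y K (fun t => (sval t).1) A V cV VT; first by [].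
  move=> a; suff -> : (fun t : pt => (sval t).1) @^-1` V a = [set t | exists b, mem (a, b) t].
    by apply: clopen_upset_bigcup => b; exact: ck.
  apply/seteqP; split=> [t Vt|t [b []]//].
  by have [b ?] := WT (sval t).2; exists b.
have [||p2 p2E] := @atlas_hom d X Z K (fun t => (sval t).2) B W cW WT.
- by move=> [[y z] /= yz].
- move=> b; suff -> : (fun t : pt => (sval t).2) @^-1` W b = [set t | exists a, mem (a, b) t].
    by apply: clopen_upset_bigcup => a; exact: ck.
  apply/seteqP; split=> [t Wt|t [a []]//].
  by have [a ?] := VT (sval t).1; exists a.
exists (atlas_object K), p1, p2; rewrite /pointwise_product p1E p2E; split.
  by move=> [[y z] /= yz] [[y' z'] /= yz'] /= yy' zz'; apply: eq_exist; congr (_, _).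
by move=> y z yz; exists (exist _ (y, z) yz).
Qed.

Lemma pointwise_is_product Y Z P (p1 : hom P Y) (p2 : hom P Z) :
  pointwise_product p1 p2 -> is_product p1 p2.
Proof.
move=> [inj surj] T f g.
have /choice[h hP] : forall t, exists r, fn p1 r = fn f t /\ fn p2 r = fn g t.
  by move=> t; apply: surj; rewrite !fn_base.
have [A [V [cV VT]]] := chart_cover P.
have hb t : base (h t) = base t by rewrite -(fn_base p1) (hP t).1 fn_base.
have [|k kE] := @hom_charts d X T P A V h cV VT hb.
  move=> a; have -> : h @^-1` V a = fn f @^-1` (fn p1 @` V a) `&` fn g @^-1` (fn p2 @` V a).
    apply/seteqP; split=> [t Vt|t [[r Vr r1] [s Vs s2]]].
      by split; exists (h t) => //; [exact: (hP t).1|exact: (hP t).2].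
    have rs : r = s.
      apply: (chart_eq (cV a) Vr Vs); move: (congr1 (@base _ _ _) r1) (congr1 (@base _ _ _) s2).
      by rewrite !fn_base => -> ->.
    rewrite /preimage /=; have -> // : h t = r.
    by apply: inj; rewrite ?(hP t).1 ?(hP t).2 // rs.
  by apply: clopen_upsetI; apply: preimage_fn; apply: image_fn; exact: (cV a).1.
exists k; split.
  by split; apply: hom_ext => t; rewrite fn_comp kE; [exact: (hP t).1|exact: (hP t).2].
move=> k' [k1 k2]; apply: hom_ext => t; rewrite kE; apply: inj.
  by rewrite (hP t).1 -k1.
by rewrite (hP t).2 -k2.
Qed.

Lemma product_pointwise Y Z Q (q1 : hom Q Y) (q2 : hom Q Z) :
  is_product q1 q2 -> pointwise_product q1 q2.
Proof.
move=> pQ; have [P [p1 [p2 pP]]] := pointwise_product_exists Y Z.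
have [h [[h1 h2] _]] := pQ P p1 p2.
have [k [[k1 k2] _]] := pointwise_is_product pP q1 q2.
have hk : h \oc k = idm Q.
  have [u [_ uu]] := pQ Q q1 q2.
  rewrite -(uu (h \oc k)); last by rewrite !compmA h1 h2.
  by apply: uu; rewrite !compm1.
split=> [t t' e1 e2|y z yz].
  rewrite -[t]fn_id -[t']fn_id -hk !fn_comp; congr (fn h _).
  by apply: pP.1; rewrite -!fn_comp ?k1 ?k2.
have [t [<- <-]] := pP.2 y z yz; exists (fn h t).
by rewrite -!fn_comp h1 h2.
Qed.

(** Two morphisms agree at a point exactly when some chart contains both values,
    since these have the same base point. *)
Lemma equalizer_clopen Y Z (f g : hom Y Z) : clopen_upset [set y | fn f y = fn g y].
Proof.
have [A [V [cV VT]]] := chart_cover Z.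
have -> : [set y | fn f y = fn g y] = [set y | exists a, (fn f @^-1` V a `&` fn g @^-1` V a) y].
  apply/seteqP; split=> y /=.
    by move=> fg; have [a Va] := VT (fn f y); exists a; split=> //=; rewrite -fg.
  by move=> [a [fa ga]]; apply: (chart_eq (cV a) fa ga); rewrite !fn_base.
by apply: clopen_upset_bigcup => a; apply: clopen_upsetI; apply: preimage_fn; exact: (cV a).1.
Qed.

Lemma injective_monic Y Z (m : hom Y Z) : injective (fn m) -> monic m.
Proof.
move=> inj T g h gh; apply: hom_ext => t; apply: inj.
by rewrite -!fn_comp gh.
Qed.

(** The kernel pair exists as a clopen upset of the fibre square, and its two
    projections have to coincide. *)
Lemma monic_injective Y Z (m : hom Y Z) : monic m -> injective (fn m).
Proof.
move=> mm y y' yy'; have [P [p1 [p2 pP]]] := pointwise_product_exists Y Y.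
have byy' : base y = base y' by rewrite -(fn_base m) yy' fn_base.
have [t [t1 t2]] := pP.2 y y' byy'.
have [S [i [_ iE]]] := restriction (equalizer_clopen (m \oc p1) (m \oc p2)).
have e : p1 \oc i = p2 \oc i.
  apply: mm; apply: hom_ext => s; rewrite !compmA !fn_comp.
  have : range (fn i) (fn i s) by exists s.
  by rewrite iE.
have : [set t | fn (m \oc p1) t = fn (m \oc p2) t] t by rewrite /= !fn_comp t1 t2.
rewrite -iE => -[s _ st].
by rewrite -t1 -t2 -st -!fn_comp e.
Qed.

Lemma pointwise_is_limit (J : category) (F : functor J Et) (L : Et)
    (p : forall j, hom L (F j)) : finite_type J -> is_cone p ->
  (forall t t', base t = base t' -> (forall j, fn (p j) t = fn (p j) t') -> t = t') ->
  (forall x (y : forall j, space (F j)), (forall j, base (y j) = x) ->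
     (forall i j (u : hom i j), fn (Defs.fmap F u) (y i) = y j) ->
     exists t, base t = x /\ forall j, fn (p j) t = y j) ->
  is_limit p.
Proof.
move=> fJ cp inj surj; split=> // T q cq.
have /choice[h hP] : forall t, exists r, base r = base t /\
    forall j, fn (p j) r = fn (q j) t.
  move=> t; apply: (surj _ (fun j => fn (q j) t)).
    by move=> j; rewrite fn_base.
  by move=> i j u; rewrite -fn_comp cq.
have [A [V [cV VT]]] := chart_cover L.
have [|k kE] := @hom_charts d X T L A V h cV VT (fun t => (hP t).1).
  move=> a; have -> : h @^-1` V a = @base d X T @^-1` (@base d X L @` V a) `&`
      [set t | forall j, (fn (q j) @^-1` (fn (p j) @` V a)) t].
    apply/seteqP; split=> [t Vt|t [[r Vr rt] tq]].
      split; first by exists (h t) => //; rewrite (hP t).1.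
      by move=> j; exists (h t) => //; rewrite (hP t).2.
    rewrite /preimage /=; have -> // : h t = r.
    apply: inj => [|j]; first by rewrite (hP t).1.
    have [s Vs sq] := tq j; rewrite (hP t).2 -sq; congr (fn _ _).
    apply: (chart_eq (cV a) Vs Vr); rewrite rt.
    by move: (congr1 (@base _ _ _) sq); rewrite !fn_base.
  apply: clopen_upsetI; first by apply: preimage_base; apply: image_base; exact: (cV a).1.
  by apply: clopen_upset_bigcap => // j; apply: preimage_fn; apply: image_fn; exact: (cV a).1.
exists k; split.
  by move=> j; apply: hom_ext => t; rewrite fn_comp kE; exact: (hP t).2.
move=> k' k'P; apply: hom_ext => t; rewrite kE; apply: inj => [|j].
  by rewrite (hP t).1 fn_base.
by rewrite (hP t).2 -k'P.
Qed.

Lemma finite_type_ord (T : Type) : finite_type T ->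
  exists (n : nat) (e : 'I_n -> T) (g : T -> 'I_n), cancel e g /\ cancel g e.
Proof.
move=> [I [e [g eK gK]]]; exists #|I|, (fun i => e (enum_val i)), (fun t => enum_rank (g t)).
by split=> [i|t]; rewrite ?eK ?enum_valK // enum_rankK gK.
Qed.

Lemma EsaEt_finite_limits : has_finite_limits Et.
Proof.
move=> J F [fJ fH].
have [n [e [g [eK gK]]]] := finite_type_ord fJ.
have /choice_dep[A /choice_dep[V VP]] :
  forall i, exists (A : finType) (V : A -> set (space (F (e i)))),
  (forall a, chart (V a)) /\ forall y, exists a, V a y by move=> i; exact: chart_cover.
have cV i := (VP i).1; have VT i := (VP i).2.
(* families are indexed by ordinals, as the type of objects of J lives in too
   large a universe to be quantified over in the carrier of a space *)
pose fam := forall i : 'I_n, space (F (e i)).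
pose compat (y : fam) := forall i j (u : hom (e i) (e j)), fn (Defs.fmap F u) (y i) = y j.
pose pt := {t : X * fam | (forall i, base (t.2 i) = t.1) /\ compat t.2}.
pose idx := {dffun forall i : 'I_n, A i}.
pose mem (a : idx) : set pt := fun t => forall i, V i (a i) ((sval t).2 i).
pose f (t : pt) := (sval t).1.
have cov t : exists a, mem a t.
  have [a aP] := choice_dep (fun i => VT i ((sval t).2 i)).
  by exists (finfun a) => i; rewrite ffunE; exact: aP.
have im a b : clopen_upset (f @` (mem a `&` mem b)).
  have -> : f @` (mem a `&` mem b) =
     [set x | forall i, (@base d X _ @` (V i (a i) `&` V i (b i))) x] `&`
     [set x | forall i j (u : hom (e i) (e j)),
        (@base d X _ @` (V i (a i) `&` fn (Defs.fmap F u) @^-1` V j (a j))) x].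
    apply/seteqP; split=> [x [[[x0 y] /= [yb yc]] [/= ay by_] <-]|x [xV xF]].
      split=> [i|i j u]; first by exists (y i).
      by exists (y i); rewrite // /preimage /= yc.
    have /choice_dep [y yP] : forall i, exists y, (V i (a i) y /\ V i (b i) y) /\ base y = x.
      by move=> i; have [y ? ?] := xV i; exists y.
    have yc : compat y.
      move=> i j u; have [z [Vz Vuz] zx] := xF i j u.
      have -> : y i = z by apply: (chart_eq (cV i (a i)) (yP i).1.1 Vz); rewrite (yP i).2.
      by apply: (chart_eq (cV j (a j)) Vuz (yP j).1.1); rewrite fn_base zx (yP j).2.
    exists (exist _ (x, y) (conj (fun i => (yP i).2) yc)) => //.
    by split=> i; have [[]] := yP i.
  apply: clopen_upsetI.
    apply: clopen_upset_bigcap => [|i]; first exact: finite_type_fin.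
    by apply: image_base; apply: clopen_upsetI; exact: (cV i _).1.
  apply: clopen_upset_bigcap => [|i]; first exact: finite_type_fin.
  apply: clopen_upset_bigcap => [|j]; first exact: finite_type_fin.
  apply: clopen_upset_bigcap => [|u]; first exact: fH.
  by apply: image_base; apply: clopen_upsetI; [|apply: preimage_fn]; exact: (cV _ _).1.
have fb t i : base ((sval t).2 i) = f t by have [h _] := proj2_sig t; exact: h.
have inj a t t' : mem a t -> mem a t' -> f t = f t' -> t = t'.
  move=> at_ at' tt'; apply: sval_inj.
  have yy' : (sval t).2 = (sval t').2.
    by apply: functional_extensionality_dep => i; apply: (chart_eq (cV i (a i))); rewrite // !fb.
  by move: yy' tt'; rewrite /f; case: (sval t) => x y; case: (sval t') => x' y' /= -> ->.
pose K := @Atlas d X pt f idx mem cov inj (fun a b => (im a b).1) (fun a b => (im a b).2).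
have ck (a : idx) : clopen_upset (mem a : set (realize K)).
  exact: (@atlas_chart d X K a).1.
have /choice_dep[p pE] : forall i, exists p : hom (atlas_object K) (F (e i)),
    fn p = fun t : pt => (sval t).2 i.
  move=> i; apply: (@atlas_hom d X _ K _ (A i) (V i) (cV i) (VT i)).
    by move=> t; exact: fb.
  move=> c; suff -> : (fun t : pt => (sval t).2 i) @^-1` V i c =
      [set t | exists a : idx,
         (mem a `&` f @^-1` (@base d X _ @` (V i (a i) `&` V i c))) t].
    apply: clopen_upset_bigcup => a; apply: clopen_upsetI; first exact: ck.
    apply: (@preimage_base d X (atlas_object K)); apply: image_base.
    by apply: clopen_upsetI; exact: (cV i _).1.
  apply/seteqP; split=> [t Vt|t [a [at_ [y [Vy cy] yt]]]].
    have [a at_] := cov t; exists a; split=> //; exists ((sval t).2 i); last exact: fb.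
    by split=> //; exact: at_.
  rewrite /preimage /=; have <- // : y = (sval t).2 i.
  by apply: (chart_eq (cV i (a i)) Vy (at_ i)); rewrite fb.
pose q j : hom (atlas_object K) (F j) := ecast j (hom _ (F j)) (gK j) (p (g j)).
have qE i t : fn (q (e i)) t = (sval t).2 i.
  rewrite /q; move: (gK (e i)); rewrite (eK i) => E.
  by rewrite (Prop_irrelevance E erefl) /= pE.
have qc i k (u : hom (e i) (e k)) : Defs.fmap F u \oc q (e i) = q (e k).
  apply: hom_ext => t; rewrite fn_comp !qE.
  by have [_ tc] := proj2_sig t; exact: tc.
exists (atlas_object K), q; apply: pointwise_is_limit => //.
- by move=> a b; rewrite -(gK a) -(gK b); exact: qc.
- move=> t t' tt' qt; apply: sval_inj.
  have yy' : (sval t).2 = (sval t').2.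
    by apply: functional_extensionality_dep => i; rewrite -!qE.
  move: yy' tt'; rewrite /base /= /f.
  by case: (sval t) => x y; case: (sval t') => x' y' /= -> ->.
- move=> x y yb yc.
  exists (exist _ (x, fun i => y (e i)) (conj (fun i => yb (e i)) (fun i j u => yc _ _ u))).
  by split=> // j; rewrite -(gK j) qE.
Qed.

End Constructions.

(** * Exponentials *)

Section Topos.
Context {d : Order.disp_t} (X : esakiaSpace d).
Local Notation Et := (EsaEt X).
Implicit Types Y Z T : Et.
(* a finite test family: on the points above any given point, every clopen
   upset coincides with a member of the family *)
Variables (I : finType) (S : I -> set X).
Hypothesis cS : forall i, clopen_upset (S i).
Hypothesis locS : forall (U : set X) x, clopen_upset U ->
  exists i, forall y, x <= y -> (S i y <-> U y).

Section Exponential.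
Variables (Y Z : Et) (A B : finType) (V : A -> set (space Y)) (W : B -> set (space Z)).
Hypothesis cV : forall a, chart (V a).
Hypothesis VT : forall y, exists a, V a y.
Hypothesis cW : forall b, chart (W b).
Hypothesis WT : forall z, exists b, W b z.

Local Notation graph := (set (space Y * space Z)).
Local Notation table := {ffun A * B -> I}.

(** A germ at [x] of a map from [Y] to [Z] is recorded by its graph over the
    points above [x]. Given charts of [Y] and [Z], it is described by the clopen
    upsets where it carries the chart [a] into the chart [b]; by the test
    family finitely many tables [G] describe all germs, and these tables are
    the sections of an atlas. *)
Definition represents (G : table) (x : X) (th : graph) : Prop :=
  forall y z a b, V a y -> W b z -> x <= base y -> base z = base y ->
    (th (y, z) <-> S (G (a, b)) (base y)).

(** Naturality follows for the graphs described by a table, as the entries of a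
    table are upsets. *)
Definition germ_of_map (x : X) (th : graph) : Prop :=
  (forall y z, th (y, z) -> x <= base y /\ base z = base y) /\
  (forall y, x <= base y -> exists! z, th (y, z)).

Definition exp_pt :=
  {t : X * graph | germ_of_map t.1 t.2 /\ exists G, represents G t.1 t.2}.

Let f (t : exp_pt) := (sval t).1.
Let mem (G : table) : set exp_pt := fun t => represents G (sval t).1 (sval t).2.

Let cov t : exists G, mem G t.
Proof. by have [_] := proj2_sig t. Qed.

Lemma germ_of_map_eq x (th th' : graph) : germ_of_map x th -> germ_of_map x th' ->
  (forall y z, th (y, z) -> th' (y, z)) -> th = th'.
Proof.
move=> [gb gf] [gb' gf'] le; apply/seteqP; split=> -[y z]; first exact: le.
move=> yz; have [xy _] := gb' _ _ yz; have [w [yw _]] := gf y xy.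
have [u [_ uu]] := gf' y xy.
by have <- : w = z by rewrite -(uu z) // -(uu w) //; exact: le.
Qed.

Let inj G t t' : mem G t -> mem G t' -> f t = f t' -> t = t'.
Proof.
rewrite /f /mem; case: t t' => [[x th] /= [g eG]] [[x' th'] /= [g' eG']] Gt Gt' xx'; subst x'.
apply: sval_inj => /=; congr (_, _); apply: (germ_of_map_eq g g') => y z yz.
have [xy zy] := g.1 _ _ yz; have [a ay] := VT y; have [b bz] := WT z.
by apply/(Gt' _ _ _ _ ay bz xy zy)/(Gt _ _ _ _ ay bz xy zy).
Qed.

Let eV a a' : set X := @base d X Y @` (V a `&` V a').
Let eW b b' : set X := @base d X Z @` (W b `&` W b').

Let ceV a a' : clopen_upset (eV a a').
Proof. by apply: image_base; apply: clopen_upsetI; exact: (cV _).1. Qed.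
Let ceW a a' : clopen_upset (eW a a').
Proof. by apply: image_base; apply: clopen_upsetI; exact: (cW _).1. Qed.

(** The points over which the table [G] defines a map of fibres, the same as
    [G'] does: it is total, does not depend on the choice of charts, is single
    valued, and has the same graph as [G']. *)
Let wd (G G' : table) : set X :=
  [set q | forall a, eV a a q -> exists b, (eW b b `&` S (G (a, b))) q] `&`
  [set q | forall a a' b b', eV a a' q -> eW b b' q ->
     (S (G (a, b)) q <-> S (G (a', b')) q)] `&`
  [set q | forall a b b', eV a a q -> eW b b q -> eW b' b' q ->
     S (G (a, b)) q -> S (G (a, b')) q -> eW b b' q] `&`
  [set q | forall a b, eV a a q -> eW b b q -> (S (G (a, b)) q <-> S (G' (a, b)) q)].

Let cwd G G' : clopen (wd G G').
Proof.
have kV a a' := (ceV a a').1; have kW b b' := (ceW b b').1; have kS i := (cS i).1.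
rewrite /wd; apply: clopenI; first apply: clopenI; first apply: clopenI.
- apply: clopen_bigcap => a; apply: clopen_imply => //; apply: clopen_bigcup => b.
  exact: clopenI.
- do 4 (apply: clopen_bigcap => ?); do 2 apply: clopen_imply => //.
  exact: clopen_iff.
- do 3 (apply: clopen_bigcap => ?); do 5 apply: clopen_imply => //.
- do 2 (apply: clopen_bigcap => ?); do 2 apply: clopen_imply => //.
  exact: clopen_iff.
Qed.

(** Maps of fibres over all points above [x] make up a germ at [x] as soon as
    they come from one table, because its entries are upsets. *)
Let imE G G' : f @` (mem G `&` mem G') = box (wd G G').
Proof.
apply/seteqP; split=> [_ [[[x th] /= [[gb gf] eG]] [/= Gt Gt'] <-] q xq|x xwd].
  rewrite /f /= in xq *; split; first split; first split.
  - move=> a [y [ay _] yq]; subst q; have [z [yz _]] := gf y xq.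
    have [_ zy] := gb _ _ yz; have [b bz] := WT z; exists b; split; first by exists z.
    by apply/(Gt _ _ _ _ ay bz xq zy).
  - move=> a a' b b' [y [ay ay'] yq] [z [bz bz'] zq]; subst q.
    by rewrite -(Gt _ _ _ _ ay bz xq zq) -(Gt _ _ _ _ ay' bz' xq zq).
  - move=> a b b' [y [ay _] yq] [z [bz _] zq] [z' [bz' _] zq']; subst q.
    move=> /(Gt _ _ _ _ ay bz xq zq) yz /(Gt _ _ _ _ ay bz' xq zq') yz'.
    have [w [_ wu]] := gf y xq; have zz' : z = z' by rewrite -(wu z) // -(wu z').
    by exists z => //; split=> //; rewrite zz'.
  - move=> a b [y [ay _] yq] [z [bz _] zq]; subst q.
    by rewrite -(Gt _ _ _ _ ay bz xq zq) -(Gt' _ _ _ _ ay bz xq zq).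
pose th : graph := [set yz | [/\ x <= base yz.1, base yz.2 = base yz.1 &
  exists a b, [/\ V a yz.1, W b yz.2 & S (G (a, b)) (base yz.1)]]].
have Gth : represents G x th.
  move=> y z a b ay bz xy zy; have [[[_ ext] _] _] := xwd _ xy.
  split=> [[_ _ [a' [b' [ay' bz' Sab]]]]|Sab]; last by split=> //; exists a, b.
  by apply/(ext a a' b b') => //; [exists y|exists z].
have G'th : represents G' x th.
  move=> y z a b ay bz xy zy; have [_ gg] := xwd _ xy.
  by rewrite (Gth _ _ _ _ ay bz xy zy); apply: gg; [exists y|exists z].
have gth : germ_of_map x th.
  split=> [y z []//|y xy]; have [[[tot _] fun_] _] := xwd _ xy.
  have [a ay] := VT y; have [|b [[z [bz _] zy] Sab]] := tot a; first by exists y.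
  exists z; split; first by apply/(Gth _ _ _ _ ay bz xy zy).
  move=> z' yz'; have [_ zy' _] := yz'; have [b' bz'] := WT z'.
  move/(Gth _ _ _ _ ay bz' xy zy') : yz' => Sab'.
  have [w [bw bw'] wy] : eW b b' (base y).
    by apply: (fun_ a b b') => //; [exists y|exists z|exists z'].
  have <- : w = z by apply: (chart_eq (cW b)); rewrite // zy.
  by apply: (chart_eq (cW b')); rewrite // zy'.
exists (exist _ (x, th) (conj gth (ex_intro _ G Gth))) => //.
Qed.

Let im G G' : clopen_upset (f @` (mem G `&` mem G')).
Proof. by rewrite imE; apply: clopen_upset_box; [exact: esakiaP|exact: cwd]. Qed.

Definition exp_atlas : atlas X := @Atlas d X exp_pt f table mem cov inj
  (fun a b => (im a b).1) (fun a b => (im a b).2).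

Let E : Et := atlas_object exp_atlas.
Let gr (e : space E) : graph := (sval (e : exp_pt)).2.

Let gr_germ (e : space E) : germ_of_map (base e) (gr e).
Proof. by have [] := proj2_sig (e : exp_pt). Qed.

Let gr_table (e : space E) : exists G, represents G (base e) (gr e).
Proof. by have [] := proj2_sig (e : exp_pt). Qed.

Let gr_le (e e' : space E) y z : e <= e' -> base e' <= base y -> base z = base y ->
  gr e (y, z) <-> gr e' (y, z).
Proof.
move=> ee' ey zy; have [G Ge] := gr_table e.
have Ge' : represents G (base e') (gr e') := (@atlas_chart d X exp_atlas G).1.2 _ _ ee' Ge.
have [a ay] := VT y; have [b bz] := WT z.
have ey' : base e <= base y by apply: le_trans ey; exact: base_homo.
by rewrite (Ge _ _ _ _ ay bz ey' zy) (Ge' _ _ _ _ ay bz ey zy).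
Qed.

Let evaluation P (p1 : hom P E) (p2 : hom P Y) :
  exists ev : hom P Z, forall t, gr (fn p1 t) (fn p2 t, fn ev t).
Proof.
have bb t : base (fn p1 t) <= base (fn p2 t) by rewrite !fn_base.
have /choice[h hP] t : exists z, gr (fn p1 t) (fn p2 t, z).
  by have [_ /(_ _ (bb t))[z [? _]]] := gr_germ (fn p1 t); exists z.
have hb t : base (h t) = base t.
  by have [gb _] := gr_germ (fn p1 t); have [_ ->] := gb _ _ (hP t); rewrite fn_base.
have [|ev evE] := @hom_charts d X P Z B W h cW WT hb; last by exists ev; rewrite evE.
move=> b; suff -> : h @^-1` W b = [set t | exists G a,
    ((fn p1 @^-1` (@at_mem d X exp_atlas G) `&` fn p2 @^-1` V a) `&`
     @base d X P @^-1` (eW b b `&` S (G (a, b)))) t].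
  apply: clopen_upset_bigcup => G; apply: clopen_upset_bigcup => a.
  apply: clopen_upsetI; last by apply: preimage_base; exact: clopen_upsetI.
  apply: clopen_upsetI; apply: preimage_fn; last exact: (cV a).1.
  exact: (@atlas_chart d X exp_atlas G).1.
have zb t : base (h t) = base (fn p2 t) by rewrite hb fn_base.
apply/seteqP; split=> t /=.
  move=> bt; have [G Gt] := gr_table (fn p1 t); have [a at_] := VT (fn p2 t).
  exists G, a; split; first by [].
  split; first by exists (h t).
  by move/(Gt _ _ _ _ at_ bt (bb t) (zb t)) : (hP t); rewrite fn_base.
move=> [G [a [[Gt at_] [[z [bz _] zt] Sab]]]].
have [_ /(_ _ (bb t))[u [_ uu]]] := gr_germ (fn p1 t).
have zp : base z = base (fn p2 t) by rewrite zt fn_base.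
have <- // : z = h t.
rewrite -(uu _ (hP t)); apply/esym/uu.
by apply/(Gt _ _ _ _ at_ bz (bb t) zp); rewrite fn_base.
Qed.

Let transpose_graph T Q (q1 : hom Q T) (q2 : hom Q Y) (h : hom Q Z) (t : space T) : graph :=
  [set yz | exists r, [/\ t <= fn q1 r, fn q2 r = yz.1 & fn h r = yz.2]].

(** The transpose of [h] sends [t] to the germ at [t] of the partial
    application of [h]. A chart around [t] turns the sets where that germ
    carries one chart into another into clopen upsets of [X], to which the test
    family applies; this yields the table. *)
Let transpose T Q (q1 : hom Q T) (q2 : hom Q Y) (h : hom Q Z) :
  pointwise_product q1 q2 ->
  exists g : hom T E, forall t, gr (fn g t) = transpose_graph q1 q2 h t.
Proof.
move=> [qinj qsurj]; pose th := transpose_graph q1 q2 h.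
have thE t r z : t <= fn q1 r -> th t (fn q2 r, z) <-> z = fn h r.
  move=> tr; split=> [[r' [/= tr' rr' <-]]|->]; last by exists r.
  congr (fn h _); apply: (qinj _ _ _ rr'); apply: base_lift_unique tr' tr _.
  by have := congr1 (@base _ _ _) rr'; rewrite !fn_base.
have lift t y : base t <= base y -> exists r, t <= fn q1 r /\ fn q2 r = y.
  move=> ty; have [t' tt' ty'] := base_lift ty.
  by have [r [rt ry]] := qsurj t' y ty'; exists r; rewrite rt.
have thg t : germ_of_map (base t) (th t).
  split=> [y z [r [/= tr <- <-]]|y ty].
    by rewrite !fn_base; split=> //; rewrite -(fn_base q1); exact: base_homo.
  have [r [tr ry]] := lift t y ty; subst y; exists (fn h r).
  by split; [apply/thE|move=> z /thE ->].
have tht t : exists G : table, represents G (base t) (th t).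
  have [C0 [C [cC CT]]] := chart_cover T; have [c ct] := CT t.
  pose D ab : set X := @base d X Q @`
    (fn q1 @^-1` C c `&` (fn q2 @^-1` V ab.1 `&` fn h @^-1` W ab.2)).
  have cD ab : clopen_upset (D ab).
    apply: image_base; apply: clopen_upsetI; first by apply: preimage_fn; exact: (cC c).1.
    by apply: clopen_upsetI; apply: preimage_fn; [exact: (cV _).1|exact: (cW _).1].
  have /choice[G GP] ab := locS (base t) (cD ab).
  exists (finfun G) => y z a b ay bz ty zy; rewrite ffunE GP //.
  have [r [tr ry]] := lift t y ty; rewrite -ry thE //; split=> [zr|].
    exists r; last by rewrite fn_base.
    split; first exact: (cC c).1.2 tr ct.
    by split; rewrite /preimage /= ?ry -?zr.
  move=> [s [Cs [/= as_ bs]] sr].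
  have sy : fn q2 s = y by apply: (chart_eq (cV a)) => //; rewrite fn_base sr ry.
  have rs : fn q1 s = fn q1 r.
    apply: (chart_eq (cC c)) => //; first exact: (cC c).1.2 tr ct.
    by rewrite !fn_base sr fn_base.
  have -> : r = s by apply: qinj; rewrite // ry sy.
  by apply: (chart_eq (cW b)) => //; rewrite fn_base zy -sy fn_base.
pose g (t : space T) : exp_pt := exist _ (base t, th t) (conj (thg t) (tht t)).
have [||k kE] := @hom_atlas d X T exp_atlas g; first by [].
  move=> G.
  pose Q0 : set (space Q) := [set r | forall a b, (fn q2 @^-1` V a) r ->
     (@base d X Q @^-1` eW b b) r ->
     (@base d X Q @^-1` S (G (a, b))) r <-> (fn h @^-1` W b) r].
  have cQ0 : clopen Q0.
    apply: clopen_bigcap => a; apply: clopen_bigcap => b.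
    apply: clopen_imply; first exact: (preimage_fn q2 (cV a).1).1.
    apply: clopen_imply; first exact: (preimage_base Q (ceW b b)).1.
    apply: clopen_iff; first exact: (preimage_base Q (cS (G (a, b)))).1.
    exact: (preimage_fn h (cW b).1).1.
  (* a table represents the germ at t iff it is correct at all points of Q over
     all points above t *)
  have -> : g @^-1` (@at_mem d X exp_atlas G) = box (~` (fn q1 @` (~` Q0))).
    apply/seteqP; split=> t /=.
      move=> Gt t' tt' [r nQ0 rt']; apply: nQ0 => a b ar [z [bz _] zr].
      have tr : t <= fn q1 r by rewrite rt'.
      have ty : base t <= base (fn q2 r) by rewrite fn_base -(fn_base q1); exact: base_homo.
      have zy : base z = base (fn q2 r) by rewrite zr fn_base.
      rewrite /preimage /=; move: (Gt _ _ _ _ ar bz ty zy); rewrite /= fn_base => <-.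
      rewrite thE //; split=> [<- //|bh]; apply: (chart_eq (cW b)) => //.
      by rewrite fn_base.
    move=> Qt y z a b /= ay bz ty zy; have [r [tr ry]] := lift t y ty.
    have /(_ a b) : Q0 r by apply: contrapT => nQ; apply: (Qt _ tr); exists r.
    rewrite -ry in ay zy *; rewrite fn_base in zy *.
    rewrite /preimage /= => -> //; last by exists z.
    rewrite thE //; split=> [<- //|bh]; apply: (chart_eq (cW b)) => //.
    by rewrite fn_base.
  apply: clopen_upset_box; first exact: esakiaP.
  apply: clopen_compl; apply: etale_clopen_image; [exact: space_priestley..|exact: fn_etale|].
  exact: clopen_compl.
by exists k => t; rewrite /gr kE.
Qed.

Lemma atlas_exponential : exists (E P : Et) (p1 : hom P E) (p2 : hom P Y) (ev : hom P Z),
  is_exponential p1 p2 ev.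
Proof.
have [P [p1 [p2 pP]]] := pointwise_product_exists E Y; have [ev evP] := evaluation p1 p2.
exists E, P, p1, p2, ev; split; first exact: pointwise_is_product.
move=> T Q q1 q2 /product_pointwise pQ h.
have [g gP] := transpose h pQ; exists g; split.
  have [k [[k1 k2] _]] := pointwise_is_product pP (g \oc q1) q2.
  exists k; split=> //; apply: hom_ext => r; rewrite fn_comp.
  have := evP (fn k r); rewrite -!fn_comp k1 k2 fn_comp gP => evr.
  have [_ gf] := gr_germ (fn g (fn q1 r)).
  have [|u [_ uu]] := gf (fn q2 r); first by rewrite !fn_base.
  have <- : u = fn h r by apply: uu; rewrite gP; exists r.
  by apply/esym/uu; rewrite gP.
(* graphs of germs are functional, so one inclusion between them suffices *)
move=> g' [k [k1 k2 kev]]; apply: hom_ext => t.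
apply: sval_inj; rewrite [LHS]surjective_pairing [RHS]surjective_pairing.
congr (_, _); first exact: etrans (fn_base g t) (esym (fn_base g' t)).
rewrite -[LHS]/(gr (fn g t)) -[RHS]/(gr (fn g' t)).
have gg := gr_germ (fn g t); have gg' := gr_germ (fn g' t).
rewrite !fn_base in gg gg'; apply: (germ_of_map_eq gg gg') => y z.
rewrite gP => -[r [/= tr <- <-]].
apply/(gr_le (fn_homo g' tr)); rewrite ?fn_base //.
have := evP (fn k r); rewrite -!fn_comp k1 k2 fn_comp => kr.
by rewrite -kev; exact: kr.
Qed.

End Exponential.

Lemma EsaEt_exponentials : has_exponentials Et.
Proof.
move=> Y Z; have [A [V [cV VT]]] := chart_cover Y; have [B [W [cW WT]]] := chart_cover Z.
exact: (atlas_exponential cV VT cW WT).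
Qed.
End Topos.

(** * The subobject classifier *)

Section Terminal.
Context {d : Order.disp_t} (X : esakiaSpace d).
Local Notation Et := (EsaEt X).

Definition terminal_object : Et := @SliceOb (EsaLH d) X X (idm (X : EsaLH d)).

Lemma terminal_base (x : space terminal_object) : base x = x.
Proof. by []. Qed.

Lemma terminal_objectP : is_terminal terminal_object.
Proof.
move=> Y; exists (@SliceHom (EsaLH d) X Y terminal_object (sl_map Y) (comp1m (sl_map Y))).
by split=> // f _; apply: hom_ext => y; rewrite -[RHS]terminal_base fn_base.
Qed.

Lemma fn_terminal (Y : Et) (k : hom Y terminal_object) y : fn k y = base y.
Proof. by rewrite -[LHS]terminal_base fn_base. Qed.

End Terminal.

Section Classifier.
Context {d : Order.disp_t} (X : esakiaSpace d).
Local Notation Et := (EsaEt X).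
Variables (I : finType) (S : I -> set X).
Hypothesis cS : forall i, clopen_upset (S i).
Hypothesis locS : forall (U : set X) x, clopen_upset U ->
  exists i, forall y, x <= y -> (S i y <-> U y).

Let germ x (U : set X) : set X := [set y | x <= y /\ U y].

Let germ_eqP x (U U' : set X) : germ x U = germ x U' <-> (forall y, x <= y -> (U y <-> U' y)).
Proof.
split=> [e y xy|e].
  have h : germ x U y <-> germ x U' y by rewrite e.
  by split=> Uy; [case: (h.1 (conj xy Uy))|case: (h.2 (conj xy Uy))].
by apply/seteqP; split=> y [xy Uy]; split=> //; apply/(e y xy).
Qed.

(** Over [x] lie the upsets of the set of points above [x]; only traces of
    members of the test family are taken, and these exhaust the traces of all
    clopen upsets. *)
Definition omega_pt := {t : X * set X | exists i, t.2 = germ t.1 (S i)}.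

Let f (t : omega_pt) := (sval t).1.
Let mem (i : I) : set omega_pt := fun t => (sval t).2 = germ (sval t).1 (S i).

Let cov t : exists i, mem i t.
Proof. exact: (proj2_sig t). Qed.

Let inj i t t' : mem i t -> mem i t' -> f t = f t' -> t = t'.
Proof.
case: t t' => [[x u] /= tP] [[x' u'] /= tP'] /= e e' xx'; apply: sval_inj => /=.
by move: e e' xx'; rewrite /mem /f /= => -> -> ->.
Qed.

Let im i j : clopen_upset (f @` (mem i `&` mem j)).
Proof.
have -> : f @` (mem i `&` mem j) = box [set x | S i x <-> S j x].
  apply/seteqP; split=> [_ [[[x u] /= tP] [/= ui uj] <-]|x xij].
    by apply/germ_eqP; move: ui uj; rewrite /mem /f /= => <- <-.
  exists (exist _ (x, germ x (S i)) (ex_intro _ i erefl)) => //.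
  by split=> //; apply/germ_eqP.
by apply: clopen_upset_box; [exact: esakiaP|apply: clopen_iff; exact: (cS _).1].
Qed.

Let K := @Atlas d X omega_pt f I mem cov inj
  (fun a b => (im a b).1) (fun a b => (im a b).2).
Let Omega : Et := atlas_object K.
Let val_of (t : space Omega) : set X := (sval (t : omega_pt)).2.

Let val_up (t t' : space Omega) q : t <= t' -> base t' <= q -> val_of t q <-> val_of t' q.
Proof.
move=> tt' t'q; have [i ti] := cov t.
have t'i := (@atlas_chart d X K i).1.2 _ _ tt' ti.
rewrite /val_of; move: ti t'i; rewrite /= /mem => -> ->.
by split=> -[_ ?]; split=> //; apply: le_trans t'q; exact: (base_homo tt').
Qed.

Let Omega_eq (t t' : space Omega) : base t = base t' -> val_of t = val_of t' -> t = t'.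
Proof.
move=> bb vv; apply: sval_inj; rewrite [LHS]surjective_pairing [RHS]surjective_pairing.
by congr (_, _).
Qed.

(** The characteristic map sends [y] to the set of base points of those points
    above [y] that belong to [U]. *)
Let char_exists (Y : Et) (U : set (space Y)) : clopen_upset U ->
  exists chi : hom Y Omega, forall y y', y <= y' -> val_of (fn chi y) (base y') <-> U y'.
Proof.
move=> cU; pose u (y : space Y) : set X := [set q | exists y', [/\ y <= y', base y' = q & U y']].
have uP y y' : y <= y' -> u y (base y') <-> U y'.
  move=> yy'; split=> [[z [yz zy' Uz]]|Uy']; last by exists y'.
  by have <- : z = y' by exact: base_lift_unique yz yy' zy'.
have [A [V [cV VT]]] := chart_cover Y.
have chi0 y : exists i, u y = germ (base y) (S i).
  have [a ay] := VT y.
  have [i iP] := locS (base y) (image_base (clopen_upsetI (cV a).1 cU)).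
  exists i; apply/seteqP; split=> [q [y' [yy' <- Uy']]|q [yq Sq]].
    have bb := base_homo yy'; split=> //; apply/(iP _ bb).
    by exists y' => //; split=> //; exact: (cV a).1.2 yy' ay.
  have [y' [ay' Uy'] yq'] := (iP _ yq).1 Sq; exists y'; split=> //.
  by apply: (chart_le (cV a)); rewrite // yq'.
pose chi y : omega_pt := exist _ (base y, u y) (chi0 y).
have [||k kE] := @hom_atlas d X Y K chi; first by [].
  move=> i; have -> : chi @^-1` (@at_mem d X K i) =
      box [set y | U y <-> (@base d X Y @^-1` S i) y].
    apply/seteqP; split=> y /=.
      move=> yi z yz; rewrite /= -(uP _ _ yz) [u y]yi; split=> [[]//|Sz].
      by split=> //; exact: base_homo.
    move=> yi; apply/seteqP; split=> [q [y' [yy' <- Uy']]|q [yq Sq]].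
      by split; [exact: base_homo|apply/(yi _ yy')].
    have [y' yy' yq'] := base_lift yq; subst q; exists y'; split=> //.
    by apply/(yi _ yy').
  apply: clopen_upset_box; first exact: esakiaP.
  by apply: clopen_iff; [exact: cU.1|exact: (preimage_base Y (cS i)).1].
exists k => y y' yy'; rewrite kE; exact: uP.
Qed.

(** Values of a map into [Omega] restrict, so the value at [y] is determined by
    whether the values at the points above [y] are true. *)
Let char_eq (Y : Et) (chi chi' : hom Y Omega) :
  (forall y, val_of (fn chi y) (base y) <-> val_of (fn chi' y) (base y)) -> chi = chi'.
Proof.
move=> cc; apply: hom_ext => y; apply: Omega_eq; first by rewrite !fn_base.
have below (t : space Omega) q : val_of t q -> base t <= q.
  by have [i ti] := cov t; rewrite /val_of ti => -[].
suff le (a b : hom Y Omega) :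
   (forall y, val_of (fn a y) (base y) <-> val_of (fn b y) (base y)) ->
   val_of (fn a y) `<=` val_of (fn b y).
  by apply/seteqP; split; apply: le => // z; rewrite cc.
move=> ab q aq; have := below _ _ aq; rewrite fn_base => /base_lift[y' yy' yq]; subst q.
apply/(val_up (fn_homo b yy')); first by rewrite fn_base.
by rewrite -ab; apply/(val_up (fn_homo a yy')) => //; rewrite fn_base.
Qed.

Lemma EsaEt_classifier : has_subobject_classifier Et.
Proof.
have [tr trP] := @char_exists (terminal_object X) setT (clopen_upsetT _).
have trv (t : space Omega) : val_of t (base t) <-> t = fn tr (base t).
  split=> [vt|->]; last by rewrite fn_base; apply/(trP _ (base t)).
  apply: Omega_eq; first by rewrite fn_base.
  have [i ti] := cov t.
  have [_ Sit] : germ (base t) (S i) (base t) by move: vt; rewrite /val_of ti.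
  apply/seteqP; split=> [q|q vq].
    by rewrite [X in X q -> _]ti => -[tq _]; apply/(trP (base t) q).
  have [tq _] : germ (base t) setT q.
    have [j tj] := cov (fn tr (base t)); move: vq; rewrite /val_of tj => -[].
    by rewrite -[X in X <= _]/(base (fn tr (base t))) fn_base.
  by rewrite /val_of ti; split=> //; exact: (cS i).2 tq Sit.
exists (terminal_object X), Omega, tr; split; first exact: terminal_objectP.
move=> Y U m mm; have minj := monic_injective mm.
have [chi chiP] := char_exists (image_fn m (clopen_upsetT _)).
have chiv y : range (fn m) y <-> fn chi y = fn tr (base y).
  rewrite -(chiP y y) // -[X in val_of _ X](fn_base chi) trv.
  by rewrite fn_base.
have [k [_ _]] := terminal_objectP U.
exists chi; split.
  exists k; split.
    by apply: hom_ext => u; rewrite !fn_comp fn_terminal -(fn_base m); apply/chiv; exists u.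
  move=> T u v uv.
  have [|h hu] := hom_factor (g := u) minj.
    move=> t; have [|s _ su] := (chiv (fn u t)).2; last by exists s.
    by rewrite -fn_comp uv fn_comp fn_terminal fn_base.
  exists h; split; first by split=> //; apply: hom_ext => t; rewrite !fn_terminal.
  by move=> h' [h'u _]; apply: mm; rewrite hu.
move=> chi' [k' [sq pb]]; apply: char_eq => y.
have tv (c : hom Y Omega) : val_of (fn c y) (base y) <-> fn c y = fn tr (base y).
  by rewrite -[X in val_of _ X](fn_base c) trv fn_base.
rewrite !tv -chiv; split=> [[u _ <-]|cy].
  by rewrite -fn_comp sq fn_comp fn_terminal fn_base.
have [q [q1 _]] := terminal_objectP Y.
have [R [i [_ iE]]] := restriction (equalizer_clopen chi' (tr \oc q)).
have [w [w1 _]] := terminal_objectP R.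
have [|h [[hi _] _]] := pb R i w.
  apply: hom_ext => r; have : range (fn i) (fn i r) by exists r.
  by rewrite iE /= !fn_comp !fn_terminal fn_base.
have : [set y | fn chi' y = fn (tr \oc q) y] y by rewrite /= fn_comp fn_terminal.
by rewrite -iE => -[r _ <-]; exists (fn h r); rewrite // -fn_comp hi.
Qed.

End Classifier.

(** * Truth values over the spectrum *)

Section SpecH.
Context {d : Order.disp_t} (H : heytingType d).
Local Notation X := (Spec H).
Local Notation Et := (EsaEt X).

Lemma filter_join (F : spec H) (I : finType) (u : I -> H) :
  spec_val F (\join_i u i) -> exists i, spec_val F (u i).
Proof.
apply: contraPP => /forallNP nu; elim/big_rec: _ => [|i x _ nx].
  exact: prime_filter0 (spec_prime F).
by move=> /(prime_filterU (spec_prime F))[/nu|].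
Qed.

Lemma spec_basic_upset (a : H) : clopen_upset (spec_basic a : set X).
Proof.
split; first exact: spec_basic_clopen.
by move=> F G /asboolP FG; exact: FG.
Qed.

Lemma spec_basic_sub (a b : H) : (a <= b) <-> (spec_basic a `<=` spec_basic b).
Proof.
split=> [ab F|ab]; first exact: (lfilterS (spec_prime F) ab).
apply: contrapT => nab; have [|//|G [aG]] := @prime_filter_ext _ H [set x | a <= x] b.
- split=> [|x y|x y xy ax] /=; first exact: lex1.
  + by rewrite lexI => -> ->.
  + exact: le_trans ax xy.
by apply; apply: ab; apply: aG => /=.
Qed.

Lemma spec_ext (x y : H) : (forall p : spec H, spec_val p x <-> spec_val p y) -> x = y.
Proof.
by move=> h; apply/eqP; rewrite eq_le; apply/andP; split; apply/spec_basic_sub => p /h.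
Qed.

Lemma spec_meet (p : spec H) x y : spec_val p (Order.meet x y) <-> spec_val p x /\ spec_val p y.
Proof.
have P := spec_prime p; split=> [xy|[]]; last exact: lfilterI P x y.
by split; apply: (lfilterS P) xy; [exact: leIl|exact: leIr].
Qed.

Lemma spec_join (p : spec H) x y : spec_val p (Order.join x y) <-> spec_val p x \/ spec_val p y.
Proof.
have P := spec_prime p; split; first exact: prime_filterU P x y.
by case; apply: (lfilterS P); [exact: leUl|exact: leUr].
Qed.

Lemma spec_himp (p : spec H) x y :
  spec_val p (himp x y) <-> forall q : spec H, p <= q -> spec_val q x -> spec_val q y.
Proof.
split=> [pxy q /asboolP pq qx|h].
  apply: (lfilterS (spec_prime q)) (lfilterI (spec_prime q) (pq _ pxy) qx).
  by rewrite -le_himp.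
apply: contrapT => nxy; have : (~` spec_basic (himp x y)) p by [].
by rewrite -downclosure_spec_basic => -[q [qx nqy] pq]; exact: nqy (h q pq qx).
Qed.

Lemma spec_hiff (p : spec H) x y :
  spec_val p (hiff x y) <-> forall q : spec H, p <= q -> (spec_val q x <-> spec_val q y).
Proof.
rewrite spec_meet !spec_himp; split=> [[xy yx] q pq|h].
  by split; [exact: xy|exact: yx].
by split=> q pq; have [? ?] := h q pq.
Qed.

(** Compactness twice: a finite meet of elements of [F] excludes the complement
    of [U], and finitely many such basic sets cover [U]. *)
Lemma clopen_upset_basic (U : set X) : clopen_upset U -> exists a, U = spec_basic a.
Proof.
move=> [[oU cU] uU]; have cX : compact [set: X] := (esakiaP X).1.1.
have inner (F : X) : U F -> exists a, spec_val F a /\ spec_basic a `<=` U.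
  move=> UF; have cnU : compact (~` U).
    by apply: subclosed_compact cX _ => //; rewrite closedC.
  have [||G nUG|W [nUW [a [Fa Wa]]]] := @compact_induction X (~` U)
    (fun W => exists a, spec_val F a /\ W `<=` ~` spec_basic a) cnU.
  - by exists \top; split=> //; exact: lfilterT (spec_prime F).
  - move=> A B [a [Fa Aa]] [b [Fb Bb]]; exists (Order.meet a b).
    split; first exact: lfilterI (spec_prime F) _ _ Fa Fb.
    move=> G [/Aa|/Bb] nG Gab; apply: nG; apply: (lfilterS (spec_prime G)) Gab;
      [exact: leIl|exact: leIr].
  - have [a [Fa nGa]] : exists a, spec_val F a /\ ~ spec_val G a.
      apply: contrapT => h; apply: nUG; apply: uU UF; apply/asboolP => a Fa.
      by apply: contrapT => nGa; apply: h; exists a.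
    exists (~` spec_basic a); split; [|by []|by exists a; split].
    exact: (clopen_compl (spec_basic_clopen a)).1.
  exists a; split=> // G Ga; apply: contrapT => nUG.
  exact: (Wa G (nUW G nUG) Ga).
have [||F UF|W [UW [a [aU Wa]]]] := @compact_induction X U
    (fun W => exists a, spec_basic a `<=` U /\ W `<=` spec_basic a)
    (subclosed_compact cU cX (subsetT U)).
- by exists \bot; split=> // G /(prime_filter0 (spec_prime G)).
- move=> A B [a [aU Aa]] [b [bU Bb]]; exists (Order.join a b); split=> G.
    by move=> /(prime_filterU (spec_prime G))[/aU|/bU].
  by move=> [/Aa|/Bb] h; apply: (lfilterS (spec_prime G)) h; [exact: leUl|exact: leUr].
- have [a [Fa aU]] := inner F UF; exists (spec_basic a); split; [|by []|by exists a; split].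
  exact: (spec_basic_clopen a).1.
by exists a; apply/seteqP; split=> // F /UW /Wa.
Qed.

(** Jibladze's law for a mere finite family in place of a homomorphism from a
    finite Heyting algebra. *)
Definition finitely_tested := exists (I : finType) (u : I -> H),
  forall x, \join_i hiff x (u i) = \top.

Lemma tested_topos : finitely_tested -> elementary_topos Et.
Proof.
move=> [I [u uP]]; pose S i : set X := spec_basic (u i).
have cS i : clopen_upset (S i) := spec_basic_upset (u i).
have locS (U : set X) x : clopen_upset U -> exists i, forall y, x <= y -> (S i y <-> U y).
  move=> /clopen_upset_basic[a ->].
  have : spec_val x (\join_i hiff a (u i)) by rewrite uP; exact: lfilterT (spec_prime x).
  move=> /filter_join[i /spec_hiff ai]; exists i => y xy.
  by split=> /(ai y xy).
split; [exact: EsaEt_finite_limits|exact: EsaEt_exponentials cS locS|].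
exact: EsaEt_classifier cS locS.
Qed.

Local Notation one := (terminal_object X).

(** The charts of a finite cover, as subobjects, are subterminal. *)
Lemma EsaEt_finitely_propositional : finitely_propositional one.
Proof.
move=> Y; have [A [V [cV VT]]] := chart_cover Y.
have /choice_dep[S /choice_dep[i iP]] a := restriction (cV a).1.
exists A, S, i; split.
  move=> Z g h gh; apply: hom_ext => y; have [a ay] := VT y.
  have [_ iE] := iP a; move: ay; rewrite -iE => -[s _ <-].
  by rewrite -!fn_comp gh.
move=> a; have [k [_ _]] := terminal_objectP (S a); exists k.
have [inj iE] := iP a.
apply: injective_monic => s t; rewrite !fn_terminal => st; apply: inj.
have r v : V a (fn (i a) v) by rewrite -iE; exists v.
by apply: (chart_eq (cV a)); rewrite // !fn_base.
Qed.

Lemma mono_leP (Y : Et) (m n : mono_into Y) : mono_le m n <-> (range (fn m) `<=` range (fn n)).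
Proof.
split=> [[h hm] y [s _ <-]|mn]; first by exists (fn h s); rewrite // -fn_comp hm.
apply: hom_factor; first exact: monic_injective (@mono_monic _ _ n).
by move=> z; have [|s _ sz] := mn (fn m z); [exists z|exists s].
Qed.

Lemma EsaEt_subobjects : iso_subobjects H one.
Proof.
have /choice[m mE] a : exists m : mono_into one, range (fn m) = spec_basic a.
  have [S [i [inj iE]]] := @restriction d X one _ (spec_basic_upset a).
  by exists (MonoInto (injective_monic inj)).
pose cl a : mono_into one -> Prop := fun n => mono_le (m a) n /\ mono_le n (m a).
have clE a n : cl a n <-> range (fn n) = spec_basic a.
  rewrite /cl !mono_leP mE; split=> [[h1 h2]|->]; last by split.
  exact/seteqP.
have clP a : exists m, forall n, cl a n <-> (mono_le m n /\ mono_le n m) by exists (m a).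
pose f a := SubobjectClass (clP a).
have le a b : a <= b <-> sub_le (f a) (f b).
  rewrite spec_basic_sub; split=> [ab|[p [q [/clE pE /clE qE /mono_leP]]]].
    by exists (m a), (m b); split; [apply/clE; exact: mE..|apply/mono_leP; rewrite !mE].
  by rewrite pE qE.
exists f; split=> //.
have finj : injective f.
  move=> a b fab; apply/eqP; rewrite eq_le; apply/andP.
  have r : sub_le (f b) (f b) by apply/le.
  by split; apply/le; rewrite ?fab.
have fsurj (s : subobject one) : exists a, f a = s.
  have [n nP] := sub_classP s.
  have [a aE] := clopen_upset_basic (image_fn n (clopen_upsetT _)).
  have E : cl a = sub_class s.
    apply/funext => p; apply/propext; rewrite clE nP !mono_leP aE.
    by split=> [->|[h1 h2]]; [split|exact/seteqP].
  exists a; case: s n nP aE E => c cP /= n nP aE E; subst c.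
  by congr SubobjectClass; exact: Prop_irrelevance.
have /choice[g gP] := fsurj.
by exists g => // a; apply: finj; rewrite gP.
Qed.

End SpecH.

(** * Truth values of a finitely propositional topos *)

Section Parallel.

(** The category with two parallel arrows from [false] to [true]. *)
Definition parallel_hom (a b : bool) : Type :=
  if a then (if b then unit else void) else (if b then bool else unit).

Definition parallel_id a : parallel_hom a a :=
  match a with true => tt | false => tt end.

Definition parallel_comp a b c : parallel_hom b c -> parallel_hom a b -> parallel_hom a c :=
  match a, b, c with
  | true, true, true => fun _ _ => tt
  | false, false, false => fun _ _ => tt
  | false, true, true => fun _ f => f
  | false, false, true => fun f _ => f
  | false, true, false => fun _ _ => tt
  | true, false, true => fun _ _ => tt
  | true, false, false => fun _ f => f
  | true, true, false => fun f _ => f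
  end.

Definition parallel : category.
Proof.
apply: (@Category bool parallel_hom parallel_id parallel_comp).
- by case=> [] [] // [].
- by case=> [] [] // [].
- by case=> [] [] [] [] // [].
Defined.

Lemma parallel_finite : finite_category parallel.
Proof.
split; first exact: finite_type_fin.
by case=> [] []; exact: finite_type_fin.
Qed.

Variables (C : category) (a b : C) (f g : hom a b).

Definition parallel_ob (i : parallel) : C := if i then b else a.

Definition parallel_map (i j : parallel) : hom i j -> hom (parallel_ob i) (parallel_ob j) :=
  match i, j return parallel_hom i j -> hom (parallel_ob i) (parallel_ob j) with
  | true, true => fun _ => idm b
  | false, false => fun _ => idm a
  | false, true => fun u : bool => if u then f else g
  | true, false => fun u : void => match u with end
  end.

Definition parallel_diagram : functor parallel C.
Proof.
apply: (@Functor parallel C parallel_ob parallel_map); first by case.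
by case=> [] [] [] [] // [] //=; rewrite ?comp1m ?compm1.
Defined.

Lemma equalizer_exists : has_finite_limits C ->
  exists (e : C) (i : hom e a), [/\ f \oc i = g \oc i, monic i &
    forall z (h : hom z a), f \oc h = g \oc h -> exists k : hom z e, i \oc k = h].
Proof.
move=> /(_ parallel parallel_diagram parallel_finite)[e [p [cp lp]]].
have pf := cp false true true; have pg := cp false true false.
rewrite /= in pf pg.
have fac z (h : hom z a) : f \oc h = g \oc h -> exists! k : hom z e, p false \oc k = h.
  move=> fgh; pose q (j : parallel) : hom z (parallel_ob j) :=
    match j with true => f \oc h | false => h end.
  have [|k [kq ku]] := lp z q.
    by case=> [] [] [] //=; rewrite ?comp1m.
  exists k; split; first exact: (kq false).
  move=> k' k'h; apply: ku => -[] //=.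
  by rewrite -pf -compmA k'h.
exists e, (p false); split; first by rewrite pf pg.
  move=> z u v uv; have [|k [_ ku]] := fac z (p false \oc v).
    by rewrite !compmA pf pg.
  by rewrite -(ku u) // -(ku v).
by move=> z h /fac[k [? _]]; exists k.
Qed.

End Parallel.

Lemma monic_comp (C : category) (a b c : C) (m : hom b c) (n : hom a b) :
  monic m -> monic n -> monic (m \oc n).
Proof. by move=> mm nn z g h; rewrite -!compmA => /mm/nn. Qed.

Lemma terminal_eq (C : category) (t z : C) (f g : hom z t) : is_terminal t -> f = g.
Proof. by move=> /(_ z)[k [_ ku]]; rewrite -(ku f) // -(ku g). Qed.

Section Truth.
Variables (C : category) (t omega : C) (tr : hom t omega).
Hypothesis trP : is_subobject_classifier tr.

(** Truth of a generalized element, which turns the pullback property of a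
    characteristic map into an equivalence between truth and factorization. *)
Definition holds (z : C) (p : hom z omega) : Prop := exists k : hom z t, p = tr \oc k.

Definition classifies (a u : C) (chi : hom a omega) (m : hom u a) : Prop :=
  forall z (h : hom z a), holds (chi \oc h) <-> exists k, m \oc k = h.

Lemma classifies_pullback (a u : C) (chi : hom a omega) (m : hom u a) : monic m ->
  (exists k, is_pullback chi tr m k) <-> classifies chi m.
Proof.
move=> mm; have tT := trP.1; split=> [[k [sq pb]] z h|cl].
  split=> [[l /pb[w [[wh _] _]]]|[w <-]]; first by exists w.
  by exists (k \oc w); rewrite !compmA sq.
have [k kE] : holds (chi \oc m) by apply/cl; exists (idm u); rewrite compm1.
exists k; split=> // z h v hv.
have [w wh] : exists w, m \oc w = h by apply/cl; exists v.
exists w; split; first by split=> //; exact: terminal_eq.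
by move=> w' [w'h _]; apply: mm; rewrite wh.
Qed.

Lemma classifier_exists (a u : C) (m : hom u a) : monic m -> exists chi, classifies chi m.
Proof.
by move=> mm; have [chi [/(classifies_pullback _ mm) h _]] := trP.2 _ _ _ mm; exists chi.
Qed.

Lemma classifier_unique (a u : C) (m : hom u a) chi chi' : monic m ->
  classifies chi m -> classifies chi' m -> chi = chi'.
Proof.
move=> mm /(classifies_pullback _ mm) h /(classifies_pullback _ mm) h'.
by have [c [_ cu]] := trP.2 _ _ _ mm; rewrite -(cu _ h) -(cu _ h').
Qed.

End Truth.

Lemma subobject_representatives d (H : heytingType d) (C : category) (a : C) :
  iso_subobjects H a -> exists m : H -> mono_into a,
    (forall x y, x <= y <-> mono_le (m x) (m y)) /\
    forall n, exists x, mono_le n (m x) /\ mono_le (m x) n.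
Proof.
have trans (n p q : mono_into a) : mono_le n p -> mono_le p q -> mono_le n q.
  by move=> [h hn] [k kp]; exists (k \oc h); rewrite compmA kp.
have refl (n : mono_into a) : mono_le n n by exists (idm _); rewrite compm1.
move=> [f [[g fK gK] fle]].
have /choice[m mP] x := sub_classP (f x).
exists m; split=> [x y|n].
  rewrite fle; split=> [[p [q [/mP[mp pm] /mP[mq qm] pq]]]|xy].
    exact: trans (trans _ _ _ mp pq) qm.
  by exists (m x), (m y); split=> //; apply/mP.
pose c p := mono_le n p /\ mono_le p n.
have cP : exists m, forall p, c p <-> (mono_le m p /\ mono_le p m) by exists n.
exists (g (SubobjectClass cP)).
have : sub_class (f (g (SubobjectClass cP))) (m (g (SubobjectClass cP))) by apply/mP.
by rewrite gK => -[].
Qed.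

(** Cover [omega] by subterminal pieces [v i], and let [u i] be the truth value
    where the [i]-th piece is true. For a truth value [x] with name [chi], let
    [w i] be the truth value where the [i]-th piece equals [chi]; there [x] and
    [u i] agree, so [w i] lies below [hiff x (u i)]. To see that the join [W] of
    the [w i] is everything, compare the characteristic maps of [chi] and of
    its restriction to [W], both subobjects of [omega]: they agree on every
    piece by construction of [W], hence they are equal, and so [W] is top. *)
Lemma topos_tested d (H : heytingType d) (C : category) (one : C) :
  elementary_topos C -> is_terminal one -> finitely_propositional one ->
  iso_subobjects H one -> finitely_tested H.
Proof.
move=> [lim _ [t [omega [tr trP]]]] oneT fp /subobject_representatives[m [mle msurj]].
have [I [V [v [epi sub]]]] := fp omega.
have one_eq z (f g : hom z one) : f = g by exact: terminal_eq.
have /choice_dep[s sm] i : exists s : hom (V i) one, monic s by exact: sub.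
have bang z : exists b : hom z t, True by have [b _] := trP.1 z; exists b.
have bang1 z : exists b : hom z one, True by have [b _] := oneT z; exists b.
have t_eq z (f g : hom z t) : f = g by exact: terminal_eq trP.1.
have /choice[u uP] i : exists u : H, forall z (h : hom z (V i)),
    holds tr (v i \oc h) <-> exists k, m u \oc k = s i \oc h.
  have [b _] := bang (V i); have [e [j [je jm jf]]] := equalizer_exists (v i) (tr \oc b) lim.
  have [u [[k1 k1P] [k2 k2P]]] := msurj (MonoInto (monic_comp (sm i) jm)).
  exists u => z h; split=> [[l lE]|[k kE]].
    have [|k kh] := jf z h; first by rewrite lE -compmA; congr (tr \oc _); exact: t_eq.
    by exists (k1 \oc k); apply: one_eq.
  have -> : h = j \oc (k2 \oc k) by apply: (sm i); exact: one_eq.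
  by exists (b \oc (j \oc (k2 \oc k))); rewrite compmA je !compmA.
exists I, u => x.
have [chi chiP] := classifier_exists trP (@mono_monic _ _ (m x)).
have chim : monic chi by move=> z f g _; exact: one_eq.
have /choice[w wP] i : exists w : H, (exists h : hom (mono_dom (m w)) (V i), True) /\
    forall z (h : hom z (V i)),
      (exists k, m w \oc k = s i \oc h) <-> exists k, chi \oc k = v i \oc h.
  have [b _] := bang1 (V i); have [e [j [je jm jf]]] := equalizer_exists (v i) (chi \oc b) lim.
  have [w [[k1 k1P] [k2 k2P]]] := msurj (MonoInto (monic_comp (sm i) jm)).
  exists w; split; [by exists (j \oc k2)|move=> z h; split=> [[k kE]|[k kE]]].
    have -> : h = j \oc (k2 \oc k) by apply: (sm i); exact: one_eq.
    by exists (b \oc (j \oc (k2 \oc k))); rewrite [RHS]compmA je !compmA.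
  have [|l lh] := jf z h; first by rewrite -kE -compmA; congr (chi \oc _); exact: one_eq.
  by exists (k1 \oc l); apply: one_eq.
have w_hiff i : w i <= hiff x (u i).
  have [[h0 _] wPi] := wP i.
  have test c : c <= w i -> exists h : hom (mono_dom (m c)) (V i),
      s i \oc h = m c /\ v i \oc h = chi \oc m c.
    move=> /mle[k kE]; exists (h0 \oc k); split; first exact: one_eq.
    have [|k' <-] := (wPi _ (h0 \oc k)).1; first by exists k; exact: one_eq.
    by congr (chi \oc _); exact: one_eq.
  rewrite /hiff lexI !le_himp; apply/andP; split; apply/mle.
    have [h [sh vh]] := test (Order.meet (w i) x) (leIl _ _).
    rewrite /mono_le -sh; apply/uP; rewrite vh; apply/chiP.
    exact/mle/leIr.
  have [h [sh vh]] := test (Order.meet (w i) (u i)) (leIl _ _).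
  apply/chiP; rewrite -vh; apply/uP; rewrite sh.
  exact/mle/leIr.
pose W := \join_i w i.
have W1 : W = \top.
  have chiW : monic (chi \oc m W) by apply: monic_comp => //; exact: mono_monic.
  have [g gP] := classifier_exists trP chim.
  have [h hP] := classifier_exists trP chiW.
  have gh : g = h.
    apply: epi => i; have [_ wPi] := wP i.
    have [b _] := bang1 (V i); have [e [j [je jm jf]]] := equalizer_exists (v i) (chi \oc b) lim.
    have jE z (f : hom z (V i)) : (exists k, j \oc k = f) <-> exists k, chi \oc k = v i \oc f.
      split=> [[k <-]|[k kE]]; first by exists (b \oc (j \oc k)); rewrite !compmA je.
      by apply: jf; rewrite -kE -compmA; congr (chi \oc _); exact: one_eq.
    apply: (classifier_unique trP jm) => z f; rewrite -compmA jE; first exact: gP.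
    rewrite hP; split=> [[k <-]|]; first by exists (m W \oc k); rewrite compmA.
    move=> ck; have [k kE] := ck; have [l lE] := (wPi _ f).2 ck.
    have [n nE] : mono_le (m (w i)) (m W) by apply/mle; exact: joins_sup.
    by exists (n \oc l); rewrite -kE -compmA; congr (chi \oc _); exact: one_eq.
  apply/eqP; rewrite eq_le lex1; apply/mle.
  have : holds tr (h \oc chi) by rewrite -gh; apply/gP; exists (idm one); rewrite compm1.
  move=> /hP[k _]; exists (k \oc m \top); exact: one_eq.
apply/eqP; rewrite eq_le lex1 -W1 /=.
by apply/joinsP => i _; apply: le_trans (w_hiff i) _; exact: joins_sup.
Qed.

(** * From finite test families to finite Heyting algebras *)

Section FiniteSubalgebra.
Context {d : Order.disp_t} (H : heytingType d).

Record finite_subalgebra := FiniteSubalgebra {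
  fs_seq : seq H;
  fs_bot : \bot \in fs_seq;
  fs_top : \top \in fs_seq;
  fs_meet : forall x y, x \in fs_seq -> y \in fs_seq -> Order.meet x y \in fs_seq;
  fs_join : forall x y, x \in fs_seq -> y \in fs_seq -> Order.join x y \in fs_seq;
  fs_himp : forall x y, x \in fs_seq -> y \in fs_seq -> himp x y \in fs_seq
}.

Variable K : finite_subalgebra.

Definition subalgebra : Type := seq_sub (fs_seq K).
Local Notation T := subalgebra.

HB.instance Definition _ := Finite.on T.

Let bot : T := SeqSub (fs_bot K).
Let top : T := SeqSub (fs_top K).
Let meet (x y : T) : T := SeqSub (fs_meet (ssvalP x) (ssvalP y)).
Let join (x y : T) : T := SeqSub (fs_join (ssvalP x) (ssvalP y)).
Let imp (x y : T) : T := SeqSub (fs_himp (ssvalP x) (ssvalP y)).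
Let le (x y : T) : bool := ssval x <= ssval y.
Let lt (x y : T) : bool := ssval x < ssval y.

Let le_def (x y : T) : le x y = (meet x y == x).
Proof. by rewrite /le leEmeet -val_eqE. Qed.
Let lt_def (x y : T) : lt x y = (y != x) && le x y.
Proof. by rewrite /lt lt_def -val_eqE. Qed.
Let meetC : commutative meet.
Proof. by move=> x y; apply: val_inj; rewrite /= meetC. Qed.
Let joinC : commutative join.
Proof. by move=> x y; apply: val_inj; rewrite /= joinC. Qed.
Let meetA : associative meet.
Proof. by move=> x y z; apply: val_inj; rewrite /= meetA. Qed.
Let joinA : associative join.
Proof. by move=> x y z; apply: val_inj; rewrite /= joinA. Qed.
Let joinKI (y x : T) : meet x (join x y) = x.
Proof. by apply: val_inj; rewrite /= joinKI. Qed.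
Let meetKU (y x : T) : join x (meet x y) = x.
Proof. by apply: val_inj; rewrite /= meetKU. Qed.
Let meetUl : left_distributive meet join.
Proof. by move=> x y z; apply: val_inj; rewrite /= meetUl. Qed.
Let meetxx : idempotent_op meet.
Proof. by move=> x; apply: val_inj; rewrite /= meetxx. Qed.

HB.instance Definition _ := Order.isMeetJoinDistrLattice.Build d T
  le_def lt_def meetC joinC meetA joinA joinKI meetKU meetUl meetxx.

Let le0 (x : T) : (bot <= x)%O. Proof. exact: (le0x (ssval x)). Qed.
Let le1 (x : T) : (x <= top)%O. Proof. exact: (lex1 (ssval x)). Qed.

HB.instance Definition _ := Order.hasBottom.Build d T le0.
HB.instance Definition _ := Order.hasTop.Build d T le1.

Let le_imp (a b c : T) : (c <= imp a b)%O = (Order.meet c a <= b)%O.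
Proof. exact: (le_himp (ssval a) (ssval b) (ssval c)). Qed.

HB.instance Definition _ := TBDistrLattice_isHeyting.Build d T le_imp.

Definition subalgebra_val (x : T) : H := ssval x.

Lemma subalgebra_hom : heyting_hom subalgebra_val.
Proof. by []. Qed.

End FiniteSubalgebra.

Lemma etale_finite_tested d (H : heytingType d) : etale_finite H -> finitely_tested H.
Proof. by move=> [d0 [H0 [f [_ fJ]]]]; exists H0, f. Qed.

Lemma enumerate_injective (T : choiceType) (F : finType) (R : T -> Prop) (c : T -> F) :
  (forall x y, R x -> R y -> c x = c y -> x = y) ->
  exists s : seq T, forall x, (x \in s) <-> R x.
Proof.
move=> cinj; have /choice[g gP] v : exists o : option T,
    forall x, o = Some x <-> (R x /\ c x = v).
  have [[x [Rx cx]]|nx] := pselect (exists x, R x /\ c x = v).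
    exists (Some x) => y; split=> [[<-] //|[Ry cy]]; congr Some.
    by apply: cinj; rewrite // cx cy.
  by exists None => x; split=> // h; case: nx; exists x.
exists (pmap g (enum F)) => x; rewrite mem_pmap; split.
  by case/mapP => v _ /esym/gP[].
by move=> Rx; apply/mapP; exists (c x); [rewrite mem_enum|apply/esym/gP].
Qed.

Section LocalFiniteness.
Context {d : Order.disp_t} (H : heytingType d).

Lemma hiff_xx (x : H) : hiff x x = \top.
Proof. by apply/eqP; rewrite eq_le lex1 /= /hiff lexI !le_himp leIr. Qed.

Lemma hiff_trans (p : spec H) x y z :
  spec_val p (hiff x y) -> spec_val p (hiff y z) -> spec_val p (hiff x z).
Proof.
move=> /spec_hiff xy /spec_hiff yz; apply/spec_hiff => q pq.
by rewrite xy // yz.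
Qed.

Lemma hiff_meet (p : spec H) x x' y y' : spec_val p (hiff x x') -> spec_val p (hiff y y') ->
  spec_val p (hiff (Order.meet x y) (Order.meet x' y')).
Proof.
move=> /spec_hiff h /spec_hiff k; apply/spec_hiff => q pq.
by rewrite !spec_meet h // k.
Qed.

Lemma hiff_join (p : spec H) x x' y y' : spec_val p (hiff x x') -> spec_val p (hiff y y') ->
  spec_val p (hiff (Order.join x y) (Order.join x' y')).
Proof.
move=> /spec_hiff h /spec_hiff k; apply/spec_hiff => q pq.
by rewrite !spec_join h // k.
Qed.

Lemma hiff_himp (p : spec H) x x' y y' : spec_val p (hiff x x') -> spec_val p (hiff y y') ->
  spec_val p (hiff (himp x y) (himp x' y')).
Proof.
move=> /spec_hiff h /spec_hiff k; apply/spec_hiff => q pq; rewrite !spec_himp.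
have e s : q <= s -> p <= s by exact: le_trans pq.
split=> xy s qs; have {}e := e s qs.
  by rewrite -h // -k //; exact: xy.
by rewrite h // k //; exact: xy.
Qed.

(** A finitely tested algebra is locally finite. Modulo a prime filter [p] every
    element is equivalent to a test element, so the operations modulo [p] are
    described by tables on the finite index set. Two primes are alike when their
    tables, and the test elements they contain, are the same. The elements that
    alike primes reduce to a common test element form a subalgebra containing
    the test elements; each of them is determined by which of the finitely many
    types of primes contain it, so the subalgebra is finite. *)
Lemma tested_etale_finite : finitely_tested H -> etale_finite H.
Proof.
move=> [I [u uP]].
have /choice[r rP] (px : spec H * H) : exists i, spec_val px.1 (hiff px.2 (u i)).
  by apply: filter_join; rewrite uP; exact: lfilterT (spec_prime _).
pose tau (p : spec H) :=
  ([ffun ij => r (p, Order.meet (u ij.1) (u ij.2))] : {ffun I * I -> I},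
   [ffun ij => r (p, Order.join (u ij.1) (u ij.2))] : {ffun I * I -> I},
   [ffun ij => r (p, himp (u ij.1) (u ij.2))] : {ffun I * I -> I},
   r (p, \bot), r (p, \top), [set i | `[< spec_val p (u i) >]]%SET).
pose R (x : H) := forall p q, tau p = tau q ->
  exists i, spec_val p (hiff x (u i)) /\ spec_val q (hiff x (u i)).
have Ru i : R (u i).
  by move=> p q _; exists i; rewrite hiff_xx; split; exact: lfilterT (spec_prime _).
have R0 : R \bot.
  move=> p q [_ _ _ pq _ _]; exists (r (p, \bot)).
  by split; [exact: rP (p, _)|rewrite pq; exact: rP (q, _)].
have R1 : R \top.
  move=> p q [_ _ _ _ pq _]; exists (r (p, \top)).
  by split; [exact: rP (p, _)|rewrite pq; exact: rP (q, _)].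
have Rop (op : H -> H -> H) : (forall p q i j, tau p = tau q ->
      r (p, op (u i) (u j)) = r (q, op (u i) (u j))) ->
    (forall (p : spec H) x x' y y', spec_val p (hiff x x') -> spec_val p (hiff y y') ->
       spec_val p (hiff (op x y) (op x' y'))) ->
    forall x y, R x -> R y -> R (op x y).
  move=> rop cop x y Rx Ry p q pq.
  have [i [pi qi]] := Rx p q pq; have [j [pj qj]] := Ry p q pq.
  exists (r (p, op (u i) (u j))); split.
    by apply: hiff_trans (rP (p, _)); exact: cop.
  by rewrite (rop p q) //; apply: hiff_trans (rP (q, _)); exact: cop.
have RI x y : R x -> R y -> R (Order.meet x y).
  apply: Rop hiff_meet x y => p q i j [/ffunP/(_ (i, j))].
  by rewrite !ffunE.
have RU x y : R x -> R y -> R (Order.join x y).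
  apply: Rop hiff_join x y => p q i j [_ /ffunP/(_ (i, j))].
  by rewrite !ffunE.
have RH x y : R x -> R y -> R (himp x y).
  apply: Rop hiff_himp x y => p q i j [_ _ /ffunP/(_ (i, j))].
  by rewrite !ffunE.
(* the tables of the primes that contain x *)
pose code (x : H) := [set D | `[< exists p, tau p = D /\ spec_val p x >]]%SET.
have half x y : R x -> R y -> code x = code y -> spec_basic x `<=` spec_basic y.
  move=> Rx Ry xy p px.
  have : tau p \in code y by rewrite -xy inE; apply/asboolP; exists p.
  rewrite inE => /asboolP[q [qp qy]].
  have [i [qi pi]] := Ry q p qp.
  have /spec_hiff/(_ q (lexx _)) := qi; have /spec_hiff/(_ p (lexx _)) := pi.
  move=> [_ uy] [yu _]; apply: uy; have : i \in (tau q).2 by rewrite inE; apply/asboolP/yu.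
  by rewrite qp inE => /asboolP.
have code_inj x y : R x -> R y -> code x = code y -> x = y.
  by move=> Rx Ry xy; apply: spec_ext => p; split; apply: half.
have [s sP] := enumerate_injective code_inj.
have closed_s (op : H -> H -> H) : (forall x y, R x -> R y -> R (op x y)) ->
    forall x y, x \in s -> y \in s -> op x y \in s.
  by move=> h x y /sP Rx /sP Ry; apply/sP; exact: h.
pose K := FiniteSubalgebra ((sP _).2 R0) ((sP _).2 R1) (closed_s _ RI)
  (closed_s _ RU) (closed_s _ RH).
exists d, (subalgebra K : finHeytingType d), (@subalgebra_val _ _ K).
split; first exact: subalgebra_hom.
move=> x; apply/eqP; rewrite eq_le lex1 /= -(uP x).
apply/joinsP => i _; pose v : subalgebra K := SeqSub ((sP _).2 (Ru i)).
exact: (@joins_sup _ _ _ v xpredT (fun y => hiff x (subalgebra_val y))).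
Qed.
End LocalFiniteness.

(** * The equivalence *)

Theorem theorem6p5 (d : Order.disp_t) (H : heytingType d) :
  [<-> elementary_topos (EsaEt (Spec H));
       exists (E : category) (one : E),
         [/\ elementary_topos E, is_terminal one, finitely_propositional one &
             iso_subobjects H one];
       etale_finite H].
Proof.
tfae.
- move=> topos; exists (EsaEt (Spec H)), (terminal_object (Spec H)); split=> //.
  + exact: terminal_objectP.
  + exact: EsaEt_finitely_propositional.
  + exact: EsaEt_subobjects.
- move=> [E [one [topos oneT fp isoH]]]; apply: tested_etale_finite.
  exact: topos_tested topos oneT fp isoH.
- by move=> /etale_finite_tested; exact: tested_topos.
Qed.
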